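(* Let $n\ge 1$ and let $\lambda$ be a partition with at most $n$ parts. Let $\mathcal{Z}(\lambda)$ be the set of compositions $\alpha$ with $\mathrm{P}(\alpha)^{T}=\lambda$. Then the family of polynomials $\Delta_Y$, where $Y$ ranges over all row-strict composition tableaux with entries in $[n]$ of shape $\alpha$ for all $\alpha\in\mathcal{Z}(\lambda)$, is a basis (in particular its members are linearly independent) of the subspace $$\mathrm{Span}_{\mathbb{C}}\{\Delta_F : F \text{ a filling of the Young diagram of } \lambda \text{ with entries in } [n]\}\subseteq \mathbb{C}[z_{i,j}:1\le i,j\le n],$$ which is the standard realization of the irreducible $\mathrm{GL}_n(\mathbb{C})$-representation (Schur functor) $\mathbb{S}^{\lambda}(\mathbb{C}^n)$ inside the Plücker algebra.
   Context: Let $M=(z_{i,j})_{i,j=1}^n$ be the $n\times n$ matrix of indeterminates and $[n]=\{1,\dots,n\}$. For a set $I\subseteq[n]$ with $|I|=k\ge 1$, $\Delta_I$ denotes the determinant of the $k\times k$ submatrix of $M$ formed by rows $1,\dots,k$ and the columns indexed by $I$ (in increasing order); for a list of indices with a repetition the minor is $0$. The Plücker algebra $\Pi$ is the subalgebra of $\mathbb{C}[z_{i,j}]$ generated by all $\Delta_I$. The Young diagram of a partition $\lambda=(\lambda_1\ge\lambda_2\ge\dots)$ has $\lambda_i$ left-justified cells in row $i$. For a filling $F$ of it with entries in $[n]$, $\Delta_F$ is the product over the columns of $\lambda$ of $\Delta_I$, where $I$ is the list of entries in that column. A composition is a finite sequence $\alpha=(\alpha_1,\dots,\alpha_l)$ of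 positive integers (here each $\alpha_i\le n$); its diagram has $\alpha_i$ left-justified cells in row $i$. $\mathrm{P}(\alpha)$ is the partition obtained by sorting the parts of $\alpha$ into weakly decreasing order, and $\mu^T$ is the transpose (conjugate) partition of a partition $\mu$. A row-strict composition tableau (RSCT) of shape $\alpha$ with entries in $[n]$ is a filling $Y$ of the diagram of $\alpha$ with entries in $[n]$ such that: (1) entries strictly decrease along each row from left to right; (2) entries in the leftmost column weakly increase from top to bottom; (3) (row-strict triple rule) letting $m=\max_i\alpha_i$ and extending $Y$ by zero entries to an $l\times m$ rectangular array $\overline{Y}$ (with $\overline{Y}(r,c)$ the entry in row $r$, column $c$), for all $1\le i<j\le l$ and $2\le k\le m$: if $\overline{Y}(j,k)>\overline{Y}(i,k)$ then $\overline{Y}(j,k)\ge\overline{Y}(i,k-1)$. For an RSCT $Y$, $\Delta_Y$ is the product over the rows of $Y$ of $\Delta_J$, where $J$ is the set of entries of that row. *)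

(* Defs.v *)
From mathcomp Require Import all_boot all_order all_algebra.
From mathcomp Require Import reals complex mpoly.

Set Implicit Arguments.
Unset Strict Implicit.
Unset Printing Implicit Defensive.

Import GRing.Theory.
Local Open Scope ring_scope.

Section LinearAlgebra.
Variables (K : fieldType) (V : lmodType K) (I : eqType).

(* The elements [v i] with [P i] are regarded as a family indexed by [i]:
   repeated vectors are not identified in [lin_indep]. *)
Definition span (P : I -> Prop) (v : I -> V) (x : V) : Prop :=
  exists (s : seq I) (c : I -> K),
    (forall i, i \in s -> P i) /\ x = \sum_(i <- s) c i *: v i.

Definition lin_indep (P : I -> Prop) (v : I -> V) : Prop :=
  forall (s : seq I) (c : I -> K),
    uniq s -> (forall i, i \in s -> P i) ->
    \sum_(i <- s) c i *: v i = 0 -> forall i, i \in s -> c i = 0.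

Definition basis_of_subspace (W : V -> Prop) (P : I -> Prop) (v : I -> V) :
    Prop :=
  lin_indep P v /\ (forall x, W x <-> span P v x).

End LinearAlgebra.

Section Minors.
Variables (K : fieldType) (n : nat).

Definition generic_mx : 'M[{mpoly K[n * n]}]_n :=
  \matrix_(i < n, j < n) 'X_(mxvec_index i j).

Lemma card_set_ord (J : {set 'I_n}) : (#|J| <= n)%N.
Proof. by rewrite -[leqRHS]card_ord max_card. Qed.

(* [enum_val] lists the elements of [J] in increasing order. *)
Definition minor (J : {set 'I_n}) : {mpoly K[n * n]} :=
  \det (\matrix_(i < #|J|, j < #|J|)
          generic_mx (widen_ord (card_set_ord J) i) (enum_val j)).

Definition minor_list (s : seq 'I_n) : {mpoly K[n * n]} :=
  if uniq s then minor [set x in s] else 0.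

End Minors.

Section Diagrams.
Local Open Scope nat_scope.

Definition is_partition (lam : seq nat) : bool :=
  sorted geq lam && all (leq 1) lam.

Definition is_composition (n : nat) (alpha : seq nat) : bool :=
  all (fun a => 0 < a <= n) alpha.

Definition sort_parts (alpha : seq nat) : seq nat := sort geq alpha.

Definition transpose (mu : seq nat) : seq nat :=
  mkseq (fun j => count (fun a => j < a) mu) (head 0 mu).

(* A filling is the list of its rows, each row the list of its entries from
   left to right; [x : 'I_n] stands for the entry [x + 1] of {1, ..., n}. *)
Definition is_filling (n : nat) (sh : seq nat) (F : seq (seq 'I_n)) : Prop :=
  shape F = sh.

Definition column (n : nat) (F : seq (seq 'I_n)) (c : nat) : seq 'I_n :=
  pmap (fun r => onth r c) F.

Definition in_Z (n : nat) (lam alpha : seq nat) : Prop :=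
  is_composition n alpha /\ transpose (sort_parts alpha) = lam.

(* Zero-extended array, rows and columns counted from 0, with the entry
   [x : 'I_n] read as [x + 1] so that the padding is below every entry. *)
Definition extended (n : nat) (Y : seq (seq 'I_n)) (r c : nat) : nat :=
  if onth (nth [::] Y r) c is Some x then x.+1 else 0.

Definition triple_rule (n : nat) (alpha : seq nat) (Y : seq (seq 'I_n)) :
    Prop :=
  forall i j k : nat,
    i < j -> j < size alpha -> 1 <= k -> k < \max_(a <- alpha) a ->
    extended Y i k < extended Y j k -> extended Y i k.-1 <= extended Y j k.

Definition is_RSCT (n : nat) (alpha : seq nat) (Y : seq (seq 'I_n)) : Prop :=
  [/\ is_filling alpha Y,
      all (sorted (fun x y : 'I_n => y < x)) Y,
      sorted (fun x y : 'I_n => x <= y) (column Y 0)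
    & triple_rule alpha Y].

End Diagrams.

Section Polynomials.
Variables (K : fieldType) (n : nat).

Definition Delta_filling (lam : seq nat) (F : seq (seq 'I_n)) :
    {mpoly K[n * n]} :=
  \prod_(c < head 0%N lam) minor_list K (column F c).

Definition Delta_RSCT (Y : seq (seq 'I_n)) : {mpoly K[n * n]} :=
  \prod_(r <- Y) minor K [set x in r].

(* The standard realization of the Schur functor S^lam(K^n) inside the
   Pluecker algebra. *)
Definition schur_space (lam : seq nat) : {mpoly K[n * n]} -> Prop :=
  span (is_filling (n := n) lam) (Delta_filling lam).

End Polynomials.

(* Main.v *)
(** Order monomials lexicographically with the variables read column by column
    from the left, and upwards inside each column, so that the leading monomial
    of a minor is its antidiagonal.  The leading monomial of [Delta_RSCT Y] then
    records the contents of the columns of [Y], and the triple rule makes [Y]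
    recoverable from them: each column is determined by the previous one and by
    its own multiset of entries.  This gives linear independence.

    For the spanning property, every element [f] of the Schur space is killed by
    the polarizations [sum_j z_aj d/dz_bj] with [a < b] and is homogeneous in
    each row of variables.  Extracting the columns of variables one at a time,
    sl2-theory for the rows [a] and [b] shows that the row degrees of the leading
    monomial of such an [f] interlace.  Interlacing contents are exactly those
    filled greedily by some RSCT [Y], so a multiple of [Delta_RSCT Y] cancels the
    leading monomial of [f], and one concludes by induction. *)

From HB Require Import structures.
Require Import Defs.
From mathcomp Require Import all_boot all_order all_algebra.
From mathcomp Require Import perm reals complex mpoly zify ring.

Set Implicit Arguments.
Unset Strict Implicit.
Unset Printing Implicit Defensive.

Import GRing.Theory Num.Theory.

(** * Column contents of composition tableaux *)

Section TripleColumns.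
Variable l : nat.
Implicit Types p c : 'I_l -> nat.

(** The conditions on two consecutive zero-padded columns [p], [c] of a composition tableau: strict
    decrease along rows up to the padding, and the triple rule. *)
Definition triple_step p c : Prop :=
  (forall r, 0 < c r -> c r < p r) /\
  (forall i j : 'I_l, i < j -> c i < c j -> p i <= c j).

(** Only positive values are compared, so the padding zeros do not belong to the content. *)
Definition has_content c (s : seq nat) : Prop :=
  forall v, 0 < v -> #|[set r | c r == v]| = count_mem v s.

Lemma card_preim (c : 'I_l -> nat) (Q : pred nat) :
  #|[set r | Q (c r)]| = count Q [seq c r | r <- enum 'I_l].
Proof.
by rewrite count_map -sum1_count big_enum_cond sum1dep_card; apply: eq_card => r; rewrite !inE.
Qed.

Lemma has_content_card c s (Q : pred nat) :
  all (leq 1) s -> has_content c s -> ~~ Q 0 ->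
  #|[set r | Q (c r)]| = count Q s.
Proof.
move=> s0 hc Q0; rewrite card_preim.
suff /seq.permP/(_ Q) <- : perm_eq [seq x <- [seq c r | r <- enum 'I_l] | 0 < x] s.
  by rewrite count_filter; apply: eq_count => -[|x] /=; rewrite ?andbT ?(negPf Q0).
apply/allP => v _; apply/eqP; rewrite count_filter.
case: v => [|v].
  rewrite (eq_count (a2 := pred0)) => [|[|x]] //; rewrite count_pred0.
  by apply/esym/count_memPn/negP => /(allP s0).
rewrite -hc // (card_preim c (pred1 v.+1)); apply: eq_count => x /=.
by case: eqP => // ->.
Qed.

(** Uniqueness of a column given its left neighbour and its content: two candidates are compared at
    the largest value that they place differently. *)
Lemma triple_step_inj p c c' s :
  triple_step p c -> triple_step p c' -> has_content c s -> has_content c' s ->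
  c =1 c'.
Proof.
move=> hc hc' ec ec' r1; apply/eqP; apply: contraT => ne1.
have [r0 ne0 max0] := @arg_maxnP _ r1 (fun r => c r != c' r)
  (fun r => maxn (c r) (c' r)) ne1.
set y := maxn _ _ in max0.
have above r : (y < c r) || (y < c' r) -> c r = c' r.
  move=> gt; apply/eqP; apply: contraT => /max0; rewrite -/y; move: gt; lia.
(* The largest misplaced value [y] sits in as many rows of [c] as of [c'];
   the upper one of two rows distinguishing them violates the triple rule. *)
have clash a b : triple_step p a -> triple_step p b ->
    (forall r, (y < a r) || (y < b r) -> a r = b r) ->
    forall j j' : 'I_l, j' < j -> a j = y -> b j' = y -> a j' != y -> 0 < y -> False.
  move=> [_ ta] [sb _] ab j j' lt aj bj' ne y0.
  have lty : a j' < y by have := ab j'; move/eqP: ne; lia.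
  have := ta j' j lt; rewrite aj => /(_ lty); have := sb j'; lia.
have y0 : 0 < y by move/eqP: ne0; lia.
pose S := [set r | c r == y]; pose S' := [set r | c' r == y].
have cS : #|S| = #|S'| by rewrite ec // ec'.
have neS : S != S'.
  apply: contraTneq isT => eS; have : (r0 \in S) = (r0 \in S') by rewrite eS.
  by rewrite !inE; move/eqP: ne0; lia.
have nsub (X X' : {set 'I_l}) : X != X' -> #|X| = #|X'| -> exists2 j, j \in X & j \notin X'.
  move=> neX cX; apply/subsetPn; apply: contra neX => sub.
  by rewrite eqEcard sub cX leqnn.
have [j] := nsub _ _ neS cS; rewrite !inE => /eqP cj c'j.
have neS' : S' != S by rewrite eq_sym.
have [j'] := nsub _ _ neS' (esym cS).
rewrite !inE => /eqP c'j' cj'.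
have above' r : (y < c' r) || (y < c r) -> c' r = c r.
  by rewrite orbC => /above ->.
have [lt|lt|/val_inj e] := ltngtP j' j.
- by case: (clash c c' hc hc' above j j').
- by case: (clash c' c hc' hc above' j' j).
by rewrite e cj eqxx in cj'.
Qed.

(* Greedy insertion: the entries are placed from the largest to the smallest,
   each in the topmost free row whose previous entry is larger. *)
Lemma triple_step_exists p s :
  sorted geq s -> all (leq 1) s ->
  (forall t, 0 < t -> count (leq t) s <= #|[set r | t < p r]|) ->
  exists2 c, triple_step p c & has_content c s.
Proof.
elim/last_ind: s => [|s y IH] ss s0 hs.
  exists (fun _ => 0); first by split.
  move=> v v0; apply/eqP; rewrite cards_eq0; apply/eqP/setP => r.
  by rewrite !inE; lia.
have ys : all (geq^~ y) s.
  have : pairwise geq (rcons s y).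
    by rewrite -sorted_pairwise // => a b d /=; lia.
  by rewrite pairwise_rcons => /andP[].
have y0 : 0 < y by move: s0; rewrite all_rcons => /andP[].
have [||t t0|c [c1 c2] hc] := IH.
- by move: ss; rewrite -cats1 => /cat_sorted2[].
- by move: s0; rewrite all_rcons => /andP[].
- by apply: leq_trans (hs t t0); rewrite -cats1 count_cat leq_addr.
have cy r : 0 < c r -> y <= c r.
  move=> pos; have : 0 < count_mem (c r) s.
    by rewrite -hc // card_gt0; apply/set0Pn; exists r; rewrite inE.
  by rewrite -has_count has_pred1 => /(allP ys).
(* Otherwise every row with [y < p r] is already occupied. Only [size s] rows are occupied, while
   the counting hypothesis at [t = y] asks for one more. *)
have free : exists r, (c r == 0) && (y < p r).
  apply/existsP; apply: contraT; rewrite negb_exists => /forallP h.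
  have /subset_leq_card : [set r | y < p r] \subset [set r | 0 < c r].
    by apply/subsetP => r; rewrite !inE => lt; have := h r; rewrite lt andbT; lia.
  have := hs y y0.
  suff e : #|[set r | 0 < c r]| = size s.
    have -> : count (leq y) (rcons s y) = (size s).+1.
      rewrite -cats1 count_cat /= leqnn addn0 addn1; congr _.+1; apply/eqP.
      by rewrite -all_count.
    by rewrite e; lia.
  rewrite (has_content_card (Q := leq 1) _ hc) //; last by move: s0; rewrite all_rcons => /andP[].
  by apply/eqP; rewrite -all_count; move: s0; rewrite all_rcons => /andP[].
have [r0 /andP[/eqP c0 p0] min0] : exists2 r0, (c r0 == 0) && (y < p r0) &
    forall r, (c r == 0) && (y < p r) -> r0 <= r.
  have [r1 h1] := free.
  by have [r0] := @arg_minnP _ r1 (fun r => (c r == 0) && (y < p r)) val h1; exists r0.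
exists (fun r => if r == r0 then y else c r).
  split=> [r|i j lt].
    by case: eqP => [->|_] //; apply: c1.
  case: eqP => [ei|ni]; case: eqP => [ej|nj]; rewrite ?ltnn //.
  - by move=> gt; rewrite ei in lt *; apply: c2 => //; rewrite c0; lia.
  (* All entries placed so far are at least [y], so a smaller one is padding; if also [y < p i], row
     [i] would be a free row above [r0]. *)
  - move=> gt; have ci : c i = 0 by have := cy i; lia.
    rewrite leqNgt; apply/negP => lti.
    by have := min0 i; rewrite ci lti -ej leqNgt lt => /(_ isT).
  by apply: c2.
move=> v v0; rewrite -cats1 count_cat /= addn0 -hc //.
have [ev|nv] := eqVneq y v.
  rewrite (_ : [set r | (if r == r0 then y else c r) == v] = r0 |: [set r | c r == v]).
    by rewrite cardsU1 inE c0 (ltn_eqF v0) addnC.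
  by apply/setP => r; rewrite !inE; case: (r == r0); rewrite //= ev eqxx.
rewrite addn0; congr #|pred_of_set _|; apply/setP => r; rewrite !inE.
by have [->|//] := eqVneq r r0; rewrite c0 (negPf nv) (ltn_eqF v0).
Qed.

End TripleColumns.

(** Both sides say that the cell in row [a] and column [c] lies in the diagram of [mu]; the count is
    a part of the conjugate partition. *)
Lemma conjugate_lt (mu : seq nat) a c : sorted geq mu ->
  (a < count (fun x => c < x) mu) = (c < nth 0 mu a).
Proof.
elim: mu a => [|x mu IH] a /=; first by rewrite nth_nil.
move=> xmu; have smu := path_sorted xmu.
have le_x : all (geq x) mu.
  by move: xmu; rewrite path_sortedE => [/andP[]//|] u v w /=; lia.
case: (ltnP c x) => cx.
  by case: a => [|a] /=; rewrite ?cx // add1n ltnS IH.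
rewrite add0n (eqP (_ : count _ mu == 0)); last first.
  rewrite -leqn0 leqNgt -has_count; apply/hasPn => u /(allP le_x) /=; lia.
apply/esym/negbTE; rewrite -leqNgt; case: a => [//|a] /=.
have [lt|ge] := ltnP a (size mu); last by rewrite nth_default.
by have := allP le_x _ (mem_nth 0 lt); rewrite /=; lia.
Qed.

(** A form of the shape condition without sorting. The default 0 past the end of [lam] also fixes
    its length, because the parts of [lam] are positive. *)
Lemma transpose_sortP (al lam : seq nat) : is_partition lam ->
  transpose (sort_parts al) = lam <->
  forall k, count (fun a => k < a) al = nth 0 lam k.
Proof.
case/andP=> slam lam0; pose mu := sort_parts al.
have geq_total : total geq by move=> x y /=; lia.
have smu : sorted geq mu by apply: sort_sorted.
have cmu k : count (fun a => k < a) mu = count (fun a => k < a) al.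
  by apply/seq.permP; rewrite perm_sort.
have lt_head k : (k < head 0 mu) = (0 < count (fun a => k < a) al).
  by rewrite -cmu conjugate_lt // nth0.
split=> [<- k|h].
  have [lt|ge] := ltnP k (head 0 mu); first by rewrite nth_mkseq // cmu.
  rewrite nth_default ?size_mkseq //.
  by apply/eqP; rewrite -leqn0 leqNgt -lt_head -leqNgt.
have es : head 0 mu = size lam.
  have e k : (k < head 0 mu) = (k < size lam).
    rewrite lt_head h; have [lt|ge] := ltnP k (size lam).
      exact: (allP lam0 _ (mem_nth 0 lt)).
    by rewrite nth_default.
  by have := e (head 0 mu); have := e (size lam); lia.
apply: (eq_from_nth (x0 := 0)); rewrite size_mkseq // => k lt.
by rewrite nth_mkseq // cmu h.
Qed.

(** * Columns of fillings, and uniqueness of a tableau with given column contents *)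

Section Columns.
Variable n : nat.
Implicit Types Y L : seq (seq 'I_n).

(** [column] skips the rows that are too short, so positions are preserved when all such rows come
    last. *)
Lemma onth_column L k c :
  (forall i j, i < j -> size (nth [::] L i) <= k -> size (nth [::] L j) <= k) ->
  onth (column L k) c = onth (nth [::] L c) k.
Proof.
rewrite /column; elim: L c => [|r L IH] c h /=; first by rewrite nth_nil !onth0n.
have hL i j : i < j -> size (nth [::] L i) <= k -> size (nth [::] L j) <= k.
  by move=> lt; apply: (h i.+1 j.+1).
case E: (onth r k) => [x|] /=; first by case: c => [|c] //=; rewrite IH.
have rk : size r <= k by rewrite -onthNE E.
have None_L c' : onth (nth [::] L c') k = None.
  by apply: onth_default; apply: (h 0 c'.+1).
rewrite IH // None_L; case: c => [|c] /=; by rewrite ?E ?None_L.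
Qed.

Lemma count_mem_column Y k (j : 'I_n) :
  count_mem j (column Y k) = count (fun r => onth r k == Some j) Y.
Proof.
by rewrite /column; elim: Y => //= r Y <-; case: (onth r k) => [x|].
Qed.

Lemma size_column Y k : size (column Y k) = count (fun a => k < a) (shape Y).
Proof.
rewrite /column; elim: Y => //= r Y <-; rewrite -onthTE.
by case: (onth r k).
Qed.

Lemma perm_column L L' k : perm_eq L L' -> perm_eq (column L k) (column L' k).
Proof. exact: perm_pmap. Qed.

Lemma extended_eq Y Y' r r' k k' : extended Y r k = extended Y' r' k' ->
  onth (nth [::] Y r) k = onth (nth [::] Y' r') k'.
Proof.
rewrite /extended; case: (onth _ k) => [x|]; case: (onth _ k') => [y|] //.
by case=> /val_inj ->.
Qed.

Lemma extended_gt0 Y r k : (0 < extended Y r k) = (k < size (nth [::] Y r)).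
Proof. by rewrite -onthTE /extended; case: (onth _ _). Qed.

Lemma extended_content Y k l : size Y = l ->
  has_content (fun r : 'I_l => extended Y r k) [seq (val x).+1 | x <- column Y k].
Proof.
move=> <- v v0; rewrite (card_preim _ (pred1 v)).
rewrite (_ : [seq extended Y (val r) k | r <- enum 'I_(size Y)] =
  [seq (if onth r k is Some x then x.+1 else 0) | r : seq 'I_n <- Y]).
  rewrite /column; elim: Y => //= r Y ->.
  by case: (onth r k) => [x|] //=; rewrite (ltn_eqF v0).
apply: (eq_from_nth (x0 := 0)); rewrite size_map size_enum_ord ?size_map // => i lt.
by rewrite (nth_map (Ordinal lt)) ?size_enum_ord // (nth_map [::]) //= nth_enum_ord.
Qed.

Section RSCT.
Variables (al : seq nat) (Y : seq (seq 'I_n)).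
Hypothesis rsct : is_RSCT al Y.

Lemma RSCT_triple_step k l :  size Y = l ->
  triple_step (fun r : 'I_l => extended Y r k) (fun r => extended Y r k.+1).
Proof.
case: rsct => /= shY rows _ tri lY; split=> [r|i j lt lte].
  rewrite extended_gt0 => lt.
  have /(allP rows) : nth [::] Y r \in Y by rewrite mem_nth // lY.
  case E : (nth [::] Y r) lt => [//|x0 s] lt; rewrite -E in lt * => /(sortedP x0)/(_ k lt).
  rewrite /extended !onthE !(nth_map x0) //; exact: ltnW.
have jal : j < size al by rewrite -shY size_map lY.
apply: (tri i j k.+1) => //; rewrite ltnNge; apply/negP => ge.
(* A positive entry in row [j] shows that this column lies within the range of the triple rule. *)
have : 0 < extended Y j k.+1 by apply: leq_ltn_trans lte.
rewrite extended_gt0 => lt'.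
have : size (nth [::] Y j) <= \max_(a <- al) a.
  apply: (@leq_bigmax_seq _ al xpredT id) => //.
  by rewrite -shY; apply: map_f; rewrite mem_nth // lY.
by lia.
Qed.

Hypothesis al_gt0 : all (leq 1) al.

Lemma RSCT_size_column0 : size (column Y 0) = size Y.
Proof.
rewrite size_column -(size_map size Y); apply/eqP; rewrite -all_count.
by case: rsct => /= ->.
Qed.

Lemma RSCT_extended0 (r : nat) : onth (nth [::] Y r) 0 = onth (column Y 0) r.
Proof.
rewrite onth_column // => i j lt; have [iY|Yi] := ltnP i (size Y).
  have /(allP al_gt0) : size (nth [::] Y i) \in al.
    by case: rsct => /= <- _ _ _; apply: map_f; apply: mem_nth.
  lia.
by rewrite (nth_default _ (leq_trans Yi (ltnW lt))).
Qed.

End RSCT.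

(** The first column is sorted, hence determined by its content; each later one is determined by its
    predecessor through [triple_step_inj]. The shapes need not be equal beforehand. *)
Lemma RSCT_inj al al' Y Y' :
  all (leq 1) al -> all (leq 1) al' -> is_RSCT al Y -> is_RSCT al' Y' ->
  (forall k, perm_eq (column Y k) (column Y' k)) -> Y = Y'.
Proof.
move=> al0 al0' hY hY' pc.
have sz : size Y = size Y'.
  by rewrite -(RSCT_size_column0 hY al0) -(RSCT_size_column0 hY' al0') (perm_size (pc 0)).
have ext k : forall r, r < size Y -> extended Y r k = extended Y' r k.
  elim: k => [|k IH] r lt.
    rewrite /extended (RSCT_extended0 hY al0) (RSCT_extended0 hY' al0').
    suff -> : column Y 0 = column Y' 0 by [].
    case: hY hY' => _ _ s _ [_ _ s' _].
    apply: (sorted_eq (leT := fun x y : 'I_n => x <= y)) => //.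
    - by move=> x y w; apply: leq_trans.
    by move=> x y /anti_leq /val_inj.
  have := RSCT_triple_step hY k erefl; have := RSCT_triple_step hY' k (esym sz).
  move=> [st1 st2] st; 
  apply: (@triple_step_inj _ _ _ (fun r : 'I_(size Y) => extended Y' r k.+1) _
    st _ (extended_content k.+1 erefl) _ (Ordinal lt)).
    split=> [r' /st1|i j /st2 h /h]; by rewrite IH.
  move=> v v0; rewrite (extended_content _ (esym sz)) //; apply/seq.permP.
  by rewrite perm_sym; apply: perm_map.
apply: (eq_from_nth (x0 := [::])) => // r lt; apply: eq_from_onth => k.
by apply: extended_eq; apply: ext.
Qed.

End Columns.

(** * Existence of a tableau with interlacing column contents *)

Section Existence.
Variable n : nat.

Lemma row_exists (v : nat -> nat) : v 0 <= n ->
  (forall k, 0 < v k.+1 -> v k.+1 < v k) ->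
  exists row : seq 'I_n,
    forall k, (if onth row k is Some x then (val x).+1 else 0) = v k.
Proof.
have [N leN] : exists N, v 0 <= N by exists (v 0).
elim: N v leN => [|N IH] v leN vn dec; case E: (v 0) => [|x].
1,3: by exists [::]; elim=> [|k IHk]; rewrite onth0n ?E //; have := dec k;
        rewrite -IHk onth0n; lia.
  by rewrite E in leN.
have v1 : v 1 <= x by have := dec 0; lia.
have [||k|row hrow] := IH (fun k => v k.+1); try lia; first exact: dec.
have xn : x < n by lia.
by exists (Ordinal xn :: row) => -[|k] /=; rewrite ?E.
Qed.

Lemma column0_succ (Y : seq (seq 'I_n)) : all (leq 1) (shape Y) ->
  [seq (val x).+1 | x <- column Y 0] = mkseq (fun r => extended Y r 0) (size Y).
Proof.
move=> pos; transitivity [seq (if ohead r is Some x then (val x).+1 else 0) | r <- Y].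
  by rewrite /column; elim: Y pos => [|[|x r] Y IH] //= /IH ->.
apply: (eq_from_nth (x0 := 0)); rewrite size_map ?size_mkseq // => i lt.
by rewrite (nth_map [::]) // nth_mkseq.
Qed.

Variable col : nat -> seq 'I_n.
Hypothesis col_interlace : forall k t,
  count (fun x : 'I_n => t <= x) (col k.+1) <= count (fun x : 'I_n => t < x) (col k).
Hypothesis col_end : forall k, n <= k -> col k = [::].

Let content k := sort geq [seq (val x).+1 | x <- col k].
Let l := size (col 0).

Let content_count k (Q : pred nat) :
  count Q (content k) = count (fun x : 'I_n => Q x.+1) (col k).
Proof. by rewrite /content (seq.permP (permEl (perm_sort _ _))) count_map. Qed.

Let content_gt0 k : all (leq 1) (content k).
Proof. by rewrite all_sort all_map; apply/allP. Qed.

(** The first column is its content in increasing order, and the others are inserted greedily.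
    Interlacing is exactly the counting hypothesis of [triple_step_exists], up to the shift of
    entries by one. *)
Lemma columns_exist K : exists C : nat -> 'I_l -> nat,
  [/\ [seq C 0 r | r <- enum 'I_l] = sort leq [seq (val x).+1 | x <- col 0],
      forall k, k < K -> triple_step (C k) (C k.+1)
    & forall k, k <= K -> has_content (C k) (content k)].
Proof.
elim: K => [|K [C [C0 Cstep Cc]]].
  set s := sort leq _.
  have ss : size s = l by rewrite size_sort size_map.
  have e : [seq nth 0 s (val r) | r <- enum 'I_l] = s.
    by rewrite (map_comp (nth 0 s) val) val_enum_ord -ss -/(mkseq _ _) mkseq_nth.
  exists (fun _ r => nth 0 s r); split=> // k.
  rewrite leqn0 => /eqP-> v v0; rewrite (card_preim _ (pred1 v)) e.
  by rewrite content_count /s (seq.permP (permEl (perm_sort _ _))) count_map.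
have geq_total : total geq by move=> x y /=; lia.
have [t t0|c cs cc] := triple_step_exists (p := C K) (sort_sorted geq_total _) (content_gt0 K.+1).
  rewrite (has_content_card (Q := ltn t) (content_gt0 K) (Cc K (leqnn K))) //.
  by rewrite !content_count; case: t t0 => // t _; apply: col_interlace.
exists (fun k => if k == K.+1 then c else C k); split=> //= [k|k].
  rewrite ltnS eqSS => le; rewrite ltn_eqF //.
  by have [->//|ne] := eqVneq k K; apply: Cstep; rewrite ltn_neqAle ne.
have [->//|ne le] := eqVneq k K.+1; apply: Cc.
by rewrite -ltnS ltn_neqAle ne.
Qed.

(** The shape is not prescribed: the columns are filled first, and the rows with their lengths are
    then read off from them. *)
Theorem RSCT_exists : exists Y : seq (seq 'I_n),
  [/\ is_RSCT (shape Y) Y, all (leq 1) (shape Y)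
    & forall k, perm_eq (column Y k) (col k)].
Proof.
have [C0 [C00 C0step C0c]] := columns_exist n.
(* Cutting at [n] is consistent, since column [n] has empty content and is therefore already
   zero. *)
pose C k (r : 'I_l) := if k <= n then C0 k r else 0.
have Cn r : C n r = 0.
  rewrite /C leqnn; apply/eqP; rewrite -leqn0 leqNgt; apply/negP => pos.
  have := C0c n (leqnn n) _ pos; rewrite content_count col_end //= => /eqP.
  by rewrite cards_eq0 => /eqP/setP/(_ r); rewrite !inE eqxx.
have Cstep k : triple_step (C k) (C k.+1).
  have [lt|ge] := ltnP k n.
    have -> : C k.+1 = C0 k.+1 by rewrite /C lt.
    have -> : C k = C0 k by rewrite /C ltnW.
    exact: C0step.
  by have -> : C k.+1 = (fun _ => 0) by rewrite /C leqNgt ltnS ge.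
have Cc k : has_content (C k) (content k).
  have [le|gt] := leqP k n.
    have -> : C k = C0 k by rewrite /C le.
    exact: C0c.
  have -> : C k = (fun _ => 0) by rewrite /C leqNgt gt.
  move=> v v0; rewrite content_count col_end 1?ltnW //=.
  by apply/eqP; rewrite cards_eq0; apply/eqP/setP => r; rewrite !inE ltn_eqF.
have C0E : [seq C 0 r | r <- enum 'I_l] = sort leq [seq (val x).+1 | x <- col 0].
  by rewrite -C00.
have C0_in r : C 0 r \in [seq (val x).+1 | x <- col 0].
  by rewrite -(mem_sort leq) -C0E map_f // mem_enum.
have [f fE] : exists f : 'I_l -> seq 'I_n, forall r k,
    (if onth (f r) k is Some x then (val x).+1 else 0) = C k r.
  apply: (fin_all_exists (P := fun r row => forall k,
    (if onth row k is Some x then (val x).+1 else 0) = C k r)) => r.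
  apply: (row_exists (v := fun k => C k r)) => [|k pos].
    by have /mapP[x _ /= ->] := C0_in r; apply: ltn_ord.
  exact: (Cstep k).1.
pose Y := [seq f r | r <- enum 'I_l].
have sY : size Y = l by rewrite size_map size_enum_ord.
have extE (r : 'I_l) k : extended Y r k = C k r.
  rewrite /extended (nth_map r) ?size_enum_ord //.
  by rewrite (_ : nth r (enum 'I_l) r = r) ?fE //; apply: val_inj; rewrite /= nth_enum_ord.
have Ypos : all (leq 1) (shape Y).
  rewrite /shape all_map; apply/allP => row /(nthP [::])[ i]; rewrite sY => lt <- /=.
  rewrite -extended_gt0 (extE (Ordinal lt)).
  by have /mapP[x _ ->] := C0_in (Ordinal lt).
exists Y; split=> //; last first.
  move=> k; apply/allP => j _; apply/eqP.
  have := Cc k j.+1 isT; rewrite content_count.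
  have := extended_content k sY (v := j.+1) isT; rewrite count_map.
  rewrite (_ : [set r | extended Y (val r) k == j.+1] = [set r | C k r == j.+1]).
    move=> e1 e2; have E s : count (fun x : 'I_n => pred1 j.+1 x.+1) s = count_mem j s.
      by apply: eq_count => x.
    by rewrite -!E -e2 e1.
  by apply/setP => r; rewrite !inE extE.
split=> //.
- apply/allP => row /(nthP [::])[ r]; rewrite sY => lt <-.
  case E: (nth [::] Y r) => [//|x0 s]; rewrite -E.
  apply/(sortedP x0) => k lt'.
  have : 0 < extended Y r k.+1 by rewrite extended_gt0.
  rewrite (extE (Ordinal lt)) => /(Cstep k).1; rewrite -!(extE (Ordinal lt)) /=.
  by rewrite /extended !onthE !(nth_map x0) // ltnW.
- have : sorted leq [seq (val x).+1 | x <- column Y 0].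
    rewrite column0_succ // (_ : mkseq _ _ = [seq C 0 r | r <- enum 'I_l]).
      by rewrite C0E sort_sorted.
    rewrite sY /mkseq -val_enum_ord -map_comp; apply: eq_map => r /=.
    exact: extE.
  by rewrite sorted_map; apply: sub_sorted => x y.
move=> i j [//|k] ij; rewrite size_map sY => jl _ _.
have il := ltn_trans ij jl.
rewrite /= (extE (Ordinal il)) (extE (Ordinal jl)) (extE (Ordinal il)).
exact: (Cstep k).2.
Qed.

End Existence.

Local Open Scope ring_scope.

(** * Highest weight vectors and their leading monomials *)

Section Polarization.
Variables (K : numFieldType) (n : nat).

Local Notation P := {mpoly K[n * n]}.
Local Notation z a j := ('X_(mxvec_index a j) : P).

(** The operator of the matrix unit $E_{ab}$ of $\mathfrak{gl}_n$ acting on the rows of variables,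
    confined to the columns in [J]. *)
Definition polar (J : pred 'I_n) (a b : 'I_n) (p : P) : P :=
  \sum_(j | J j) z a j * mderiv (mxvec_index b j) p.

Lemma polar_is_linear J a b : linear (polar J a b).
Proof.
move=> c p q; rewrite /polar scaler_sumr -big_split /=; apply: eq_bigr => j _.
by rewrite mderivD mderivZ mulrDr scalerAr.
Qed.

HB.instance Definition _ J a b :=
  GRing.isLinear.Build K P P _ (polar J a b) (polar_is_linear J a b).

Lemma mxvec_index_eq (a b j k : 'I_n) :
  (mxvec_index a j == mxvec_index b k) = (a == b) && (j == k).
Proof.
apply/eqP/andP=> [e|[/eqP-> /eqP->]//].
have [g gK _] := curry_mxvec_bij n n.
have := gK (a, j) isT; have := gK (b, k) isT; rewrite /= e => -> [-> ->].
by rewrite !eqxx.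
Qed.

Lemma mderiv_var (a b j k : 'I_n) :
  mderiv (mxvec_index b k) (z a j) = ((a == b) && (j == k))%:R.
Proof.
rewrite mderivX mnm1E mxvec_index_eq; case: eqP => [->|_] /=; last first.
  by rewrite scale0r.
case: eqP => [->|_] /=; last by rewrite scale0r.
by rewrite scale1r (_ : _ - _ = 0)%MM ?mpolyX0 //; apply/mnmP => i; rewrite mnmBE subnn mnm0E.
Qed.

Lemma polarM J a b p q : polar J a b (p * q) = polar J a b p * q + p * polar J a b q.
Proof.
rewrite /polar mulr_suml mulr_sumr -big_split /=; apply: eq_bigr => j _.
by rewrite mderivM; ring.
Qed.

Lemma polar_var J a b c k :
  polar J a b (z c k) = if J k && (c == b) then z a k else 0.
Proof.
rewrite /polar; under eq_bigr => j _ do rewrite mderiv_var.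
case: (c == b); last by rewrite andbF big1 // => j _; rewrite mulr0.
rewrite andbT; case: ifP => Jk.
  rewrite (bigD1 k) //= eqxx mulr1 big1 ?addr0 // => j /andP[_].
  by rewrite eq_sym => /negPf->; rewrite mulr0.
rewrite big1 // => j Jj; have [e|_] := eqVneq k j; last by rewrite mulr0.
by rewrite e Jj in Jk.
Qed.

(** The commutation relations of $\mathfrak{gl}_n$: a composite of two such operators has a
    first-order part and a second-order part, and the latter is symmetric in the two operators, so
    it cancels. *)
Lemma polar_comm J a b c d p :
  polar J a b (polar J c d p) - polar J c d (polar J a b p) =
  (if b == c then polar J a d p else 0) - (if d == a then polar J c b p else 0).
Proof.
have E x y u w : polar J x y (polar J u w p) =
    (if y == u then polar J x w p else 0) +
    \sum_(j | J j) \sum_(k | J k) z x j * z u k *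
      mderiv (mxvec_index y j) (mderiv (mxvec_index w k) p).
  rewrite {1}/polar (_ : (if y == u then _ else 0) =
     \sum_(j | J j) (if y == u then z x j * mderiv (mxvec_index w j) p else 0));
    last by case: eqP => // _; rewrite big1.
  rewrite -big_split /=; apply: eq_bigr => j Jj.
  rewrite /polar raddf_sum mulr_sumr /=.
  under eq_bigr => k _ do rewrite mderivM mderiv_var mulrDr.
  rewrite big_split /=; congr (_ + _); last first.
    by apply: eq_bigr => k _; rewrite mulrA.
  rewrite (bigD1 j) //= eqxx andbT big1 => [|k /andP[_ /negPf->]]; last first.
    by rewrite andbF mul0r mulr0.
  by rewrite addr0 eq_sym; case: eqP => _; rewrite ?mul1r // mul0r mulr0.
rewrite !E [X in _ - (_ + X)]exchange_big /=.
set S1 := \sum_(j | J j) _; set S2 := \sum_(j | J j) _.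
have -> : S2 = S1.
  apply: eq_bigr => j _; apply: eq_bigr => k _.
  by rewrite mderiv_comm [z c k * _]mulrC.
by rewrite opprD addrACA subrr addr0.
Qed.

Lemma mcoeffMvar u (p : P) m :
  ('X_u * p)@_m = if (0 < m u)%N then p@_(m - U_(u)) else 0.
Proof.
case: ifP => h.
  have {1}-> : m = (U_(u) + (m - U_(u)))%MM by rewrite addmC submK // lep1mP -lt0n.
  by rewrite mulrC mcoeffMX.
rewrite mcoeffM big1 // => [[k1 k2]] /= /eqP e.
rewrite mcoeffX; case: eqP => [e1|]; last by rewrite mul0r.
have : (0 < m u)%N by rewrite e mnmDE -e1 mnm1E eqxx.
by rewrite h.
Qed.

Lemma mcoeff_polar J a b p m :
  (polar J a b p)@_m =
  \sum_(j | J j && (0 < m (mxvec_index a j))%N)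
     p@_(m - U_(mxvec_index a j) + U_(mxvec_index b j))
       *+ ((m - U_(mxvec_index a j))%MM (mxvec_index b j)).+1.
Proof.
rewrite /polar raddf_sum /= big_mkcondr /=; apply: eq_bigr => j _.
by rewrite mcoeffMvar mcoeff_deriv.
Qed.

Definition rowdeg (J : pred 'I_n) (m : 'X_{1..n * n}) (a : 'I_n) : nat :=
  \sum_(j | J j) m (mxvec_index a j).

Lemma mcoeff_polar_diag J a p m :
  (polar J a a p)@_m = (rowdeg J m a)%:R * p@_m.
Proof.
rewrite mcoeff_polar /rowdeg natr_sum mulr_suml.
rewrite [RHS](bigID (fun j => 0 < m (mxvec_index a j))%N) /=.
rewrite [X in _ = _ + X]big1 ?addr0 => [|j /andP[_]]; last first.
  by rewrite lt0n negbK => /eqP->; rewrite mul0r.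
apply: eq_bigr => j /andP[_ h]; rewrite submK ?lep1mP -?lt0n //.
by rewrite mnmBE mnm1E eqxx -subSn // subn1 mulr_natl.
Qed.

(** Weight vectors are the polynomials homogeneous in a row of variables; characteristic zero turns
    equal scalars into equal degrees. *)
Lemma polar_diag_eigen J a p (c : nat) :
  polar J a a p = c%:R *: p <-> forall m, m \in msupp p -> rowdeg J m a = c.
Proof.
split=> [e m|h].
  rewrite mcoeff_msupp => nz; have := mcoeff_polar_diag J a p m.
  rewrite e mcoeffZ => /(mulIf nz) /eqP; rewrite eqr_nat => /eqP->; done.
apply/mpolyP => m; rewrite mcoeff_polar_diag mcoeffZ.
have [/h->//|/memN_msupp_eq0->] := boolP (m \in msupp p).
by rewrite !mulr0.
Qed.

(** Weight zero means that no variable of row [a] in the columns [J] occurs, so all the derivatives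
    involved vanish. *)
Lemma polar_weight0 J a b p : polar J a a p = 0 -> polar J b a p = 0.
Proof.
move=> e; have /polar_diag_eigen h : polar J a a p = 0%:R *: p by rewrite e scale0r.
rewrite /polar big1 // => j Jj.
suff -> : mderiv (mxvec_index a j) p = 0 by rewrite mulr0.
apply/mpolyP => m; rewrite mcoeff_deriv mcoeff0.
have [/h|/memN_msupp_eq0->] := boolP ((m + U_(mxvec_index a j))%MM \in msupp p).
  by rewrite /rowdeg (bigD1 j) //= mnmDE mnm1E eqxx addn1.
by rewrite mul0rn.
Qed.

Section SL2.
Variables (J : pred 'I_n) (a b : 'I_n).
Hypothesis neq_ab : a != b.
Local Notation E := (polar J a b).
Local Notation F := (polar J b a).

(** The usual $\mathfrak{sl}_2$ formula for $[E^{k+1},F]$ on a weight vector. In the induction,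
    [E x] has weights [al + 1] and [be - 1]. *)
Lemma polar_iter_comm k (x : P) (al be : K) :
  polar J a a x = al *: x -> polar J b b x = be *: x ->
  iter k.+1 E (F x) - F (iter k.+1 E x) =
  (k.+1%:R * (al - be + k%:R)) *: iter k E x.
Proof.
elim: k x al be => [|k IH] x al be ha hb.
  by rewrite /=  polar_comm !eqxx ha hb mul1r addr0 scalerBl.
have Ex : E (F x) = F (E x) + (al - be) *: x.
  by apply/eqP; rewrite addrC -subr_eq polar_comm !eqxx ha hb scalerBl.
have ha' : polar J a a (E x) = (al + 1) *: E x.
  have := polar_comm J a a a b x; rewrite eqxx eq_sym (negPf neq_ab) subr0 ha linearZ /=.
  by move/eqP; rewrite subr_eq => /eqP->; rewrite scalerDl scale1r addrC.
have hb' : polar J b b (E x) = (be - 1) *: E x.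
  have := polar_comm J b b a b x; rewrite eqxx eq_sym (negPf neq_ab) sub0r hb linearZ /=.
  by move/eqP; rewrite subr_eq => /eqP->; rewrite scalerBl scale1r addrC.
have itD j y w (c : K) : iter j E (y + c *: w) = iter j E y + c *: iter j E w.
  by elim: j => //= i ->; rewrite linearD linearZ.
rewrite [iter k.+2 E (F x)]iterSr Ex itD [iter k.+2 E x]iterSr addrAC.
rewrite (IH _ _ _ ha' hb') -iterSr -scalerDl; congr (_ *: _).
by rewrite -[k.+2%:R]natr1 -[k.+1%:R]natr1; ring.
Qed.

(* In a finite-dimensional sl2-module, a highest weight vector of weight
   [al + 2 k - be] lying in the image of [E^k] must have weight at least [k]. *)
Lemma polar_iter_eq0 (al be k : nat) (x : P) :
  polar J a a x = al%:R *: x -> polar J b b x = be%:R *: x ->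
  (al + k < be)%N -> iter k.+1 E x = 0 -> iter k E x = 0.
Proof.
(* Induct on the degree [al] in row [a], which [F] lowers by one. At degree 0, [F x] vanishes;
   otherwise the induction hypothesis for [k + 1] applies to [F x]. In both cases [iter k E x] times
   a nonzero scalar is 0. *)
elim: al be k x => [|al IH] be k x ha hb lt hE.
all: have := polar_iter_comm k ha hb; rewrite hE linear0 subr0.
  rewrite polar_weight0 ?ha ?scale0r //.
  have -> : iter k.+1 E 0 = 0 by elim: k.+1 => //= i ->; rewrite linear0.
  move/esym/eqP; rewrite scaler_eq0 mulf_eq0 pnatr_eq0 /= sub0r addrC subr_eq0.
  by rewrite eqr_nat; case: eqP => [e|_ /eqP//]; lia.
have -> : iter k.+1 E (F x) = 0.
  apply: (IH be.+1); last first.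
  - rewrite iterS; have := polar_iter_comm k ha hb; rewrite hE linear0 subr0 => ->.
    by rewrite linearZ /= -iterS hE scaler0.
  - lia.
  - have := polar_comm J b b b a x; rewrite eqxx (negPf neq_ab) subr0 hb linearZ /=.
    by move/eqP; rewrite subr_eq => /eqP->; rewrite -natr1 scalerDl scale1r addrC.
  have := polar_comm J a a b a x; rewrite eqxx (negPf neq_ab) sub0r ha linearZ /=.
  move/eqP; rewrite subr_eq => /eqP->; rewrite -natr1 scalerDl scale1r.
  by rewrite addrC addrK.
move/esym/eqP; rewrite scaler_eq0 mulf_eq0 pnatr_eq0 /= addrAC subr_eq0 -natrD.
by rewrite eqr_nat; case: eqP => [e|_ /eqP//]; lia.
Qed.

End SL2.
End Polarization.

(** * Comparison of expansions in base [B] *)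

Section BaseExpansion.
Local Open Scope nat_scope.
Variables (I : finType) (pos : I -> nat) (B : nat).
Hypothesis pos_inj : injective pos.

Lemma base_expansion_bound (u : I -> nat) k :
  0 < B -> (forall x, u x < B) -> \sum_(x | pos x < k) u x * B ^ pos x < B ^ k.
Proof.
move=> B0 uB; elim: k => [|k IH]; first by rewrite big1.
rewrite (bigID (fun x => pos x == k)) /=.
rewrite [X in _ + X](eq_bigl (fun x => pos x < k)) => [|x]; last by lia.
suff h : \sum_(x | (pos x < k.+1) && (pos x == k)) u x * B ^ pos x <= B.-1 * B ^ k.
  rewrite expnS -[X in _ < X * _](prednK B0) mulSn; lia.
case: (pickP (fun x => pos x == k)) => [y /eqP yk|h].
  rewrite (big_pred1 y) => [|x]; first by rewrite yk leq_mul2r -ltnS prednK // uB orbT.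
  rewrite -yk ltnS /= (inj_eq pos_inj).
  by case: eqP => [->|_]; rewrite ?leqnn // andbF.
by rewrite big1 // => x; rewrite h andbF.
Qed.

(** The digits of [u] below position [pos x0] amount to less than one unit at that position, so the
    digit at [x0] decides. *)
Lemma base_expansion_lt (u v : I -> nat) x0 :
  (forall x, u x < B) -> u x0 < v x0 ->
  (forall x, pos x0 < pos x -> u x = v x) ->
  \sum_x u x * B ^ pos x < \sum_x v x * B ^ pos x.
Proof.
move=> uB lt eq_gt; have B0 : 0 < B by apply: leq_ltn_trans (uB x0).
pose hi := fun x => pos x0 < pos x.
rewrite (bigID hi) [ltnRHS](bigID hi) /= (eq_bigr (fun x => v x * B ^ pos x)).
  rewrite ltn_add2l (bigD1 x0) ?[ltnRHS](bigD1 x0) /= /hi ?ltnn //.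
  rewrite (eq_bigl (fun x => pos x < pos x0)) => [|x].
    have := base_expansion_bound (pos x0) B0 uB.
    have : u x0 * B ^ pos x0 + B ^ pos x0 <= v x0 * B ^ pos x0.
      by rewrite addnC -mulSn leq_mul2r lt orbT.
    lia.
  by rewrite -leqNgt [RHS]ltn_neqAle (inj_eq pos_inj) andbC.
by move=> x /eq_gt ->.
Qed.

Lemma base_expansion_inj (u v : I -> nat) :
  (forall x, u x < B) -> (forall x, v x < B) ->
  \sum_x u x * B ^ pos x = \sum_x v x * B ^ pos x -> u =1 v.
Proof.
move=> uB vB e x1; apply/eqP; apply: contraT => ne.
case: (@arg_maxnP I x1 (fun x => u x != v x) pos ne) => y ney max_y.
have eq_gt x : pos y < pos x -> u x = v x.
  by move=> lt; apply/eqP; apply: contraTT lt => /max_y; rewrite -leqNgt.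
have [lt|lt] : u y < v y \/ v y < u y by lia.
  by have := base_expansion_lt uB lt eq_gt; rewrite e ltnn.
have := @base_expansion_lt v u y vB lt (fun x h => esym (eq_gt x h)).
by rewrite e ltnn.
Qed.

End BaseExpansion.

(** * Leading monomials *)

Section Leading.
Variables (K : numFieldType) (n : nat) (B : nat).

Local Notation P := {mpoly K[n * n]}.
Local Notation M := 'X_{1..n * n}.
Local Notation ix a j := (mxvec_index a j).

Definition varpos (x : 'I_n * 'I_n) : nat := ((n.-1 - x.2) * n + x.1)%N.

(* For exponents below [B] this integer orders the monomials lexicographically,
   the variables being read column by column from the left, and upwards from
   the bottom row inside each column. *)
Definition key (m : M) : nat := (\sum_x m (ix x.1 x.2) * B ^ varpos x)%N.

Lemma varpos_lt (a b j k : 'I_n) :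
  (varpos (a, j) < varpos (b, k))%N = (k < j)%N || (k == j) && (a < b)%N.
Proof.
have n_gt0 : (0 < n)%N by apply: leq_ltn_trans (ltn_ord a).
rewrite /varpos /= -val_eqE /=; case: (ltngtP k j) => [lt|lt|->] /=.
- have : (n.-1 - j < n.-1 - k)%N by have := ltn_ord j; lia.
  by rewrite -(leq_pmul2r n_gt0) mulSn; have := ltn_ord a; lia.
- have : (n.-1 - k < n.-1 - j)%N by have := ltn_ord k; lia.
  by rewrite -(leq_pmul2r n_gt0) mulSn; have := ltn_ord b; lia.
by rewrite ltn_add2l.
Qed.

Lemma varpos_inj : injective varpos.
Proof.
move=> [a j] [b k] e.
have := varpos_lt a b j k; have := varpos_lt b a k j; rewrite e ltnn.
case: (ltngtP k j) => [||/val_inj->] //=; rewrite ?eqxx /=.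
by case: (ltngtP a b) => // /val_inj->.
Qed.

Lemma keyD m1 m2 : key (m1 + m2) = (key m1 + key m2)%N.
Proof.
by rewrite /key -big_split /=; apply: eq_bigr => x _; rewrite mnmDE mulnDl.
Qed.

Definition small (m : M) := forall u, (m u < B)%N.

Lemma key_inj m1 m2 : small m1 -> small m2 -> key m1 = key m2 -> m1 = m2.
Proof.
move=> s1 s2 /(base_expansion_inj varpos_inj) h; apply/mnmP => u.
by case/mxvec_indexP: u => a j; apply: (h _ _ (a, j)) => x.
Qed.

Lemma key_lt (m1 m2 : M) (a j : 'I_n) :
  small m1 -> (m1 (ix a j) < m2 (ix a j))%N ->
  (forall b (k : 'I_n), (k < j)%N -> m1 (ix b k) = m2 (ix b k)) ->
  (forall b : 'I_n, (a < b)%N -> m1 (ix b j) = m2 (ix b j)) ->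
  (key m1 < key m2)%N.
Proof.
move=> s1 lt hc hr; apply: (@base_expansion_lt _ _ _ varpos_inj _ _ (a, j)) => //.
case=> b k; rewrite varpos_lt => /orP[/hc->//|/andP[/eqP->]].
exact: hr.
Qed.

(** Dominance is measured by integer keys, which add under products but separate only small
    monomials; hence the smallness condition in [ex_lead]. *)
Definition is_lead (p : P) (m : M) : Prop :=
  p@_m != 0 /\ forall m', m' \in msupp p -> m' != m -> (key m' < key m)%N.

Lemma is_leadW p m m' : is_lead p m -> m' \in msupp p -> (key m' <= key m)%N.
Proof.
by case=> _ h sm'; have [->//|ne] := eqVneq m' m; apply/ltnW/h.
Qed.

Lemma ex_lead p : p != 0 -> (forall m, m \in msupp p -> small m) ->
  exists m, is_lead p m.
Proof.
move=> nz sm.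
have [m0 m0p] : exists m, m \in msupp p.
  case E: (msupp p) => [|m s]; last by exists m; rewrite mem_head.
  by case/eqP: nz; rewrite (mpolyE p) E big_nil.
have [i _ imax] := @arg_maxnP 'I_(size (msupp p))
  (Ordinal (introT idP (etrans (index_mem m0 _) m0p))) predT
  (fun i => key (nth 0%MM (msupp p) i)) isT.
set m := nth _ _ i in imax.
have mp : m \in msupp p by apply: mem_nth.
exists m; split; first by rewrite -mcoeff_msupp.
move=> m' m'p ne; rewrite ltn_neqAle; apply/andP; split.
  by apply: contra ne => /eqP /(key_inj (sm _ m'p) (sm _ mp)) ->.
have lt : (index m' (msupp p) < size (msupp p))%N by rewrite index_mem.
by have := imax (Ordinal lt) isT; rewrite /= nth_index.
Qed.

(** Keys add, so the pair [m1], [m2] is the only one contributing to the coefficient at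
    [m1 + m2]. *)
Lemma is_leadM p q m1 m2 : is_lead p m1 -> is_lead q m2 -> is_lead (p * q) (m1 + m2).
Proof.
move=> lp lq; case: (lp) (lq) => [p1 hp] [q1 hq].
have hM m' : m' \in msupp (p * q) -> m' != (m1 + m2)%MM -> (key m' < key (m1 + m2))%N.
  move=> /msuppM_le/allpairsP[[a b] /= [ap bq ->]] ne; rewrite !keyD.
  have [ea|/(hp _ ap) lt] := eqVneq a m1; last by rewrite -addSn leq_add ?(is_leadW lq).
  by rewrite ea ltn_add2l hq //; apply: contraNneq ne => ->; rewrite ea.
split=> //; pose p' := p - p@_m1 *: 'X_[m1].
have -> : (p * q)@_(m1 + m2) = p@_m1 * q@_m2; last by rewrite mulf_neq0.
have -> : p * q = p@_m1 *: (q * 'X_[m1]) + p' * q.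
  by rewrite /p' mulrBl -scalerAl [q * _]mulrC addrC subrK.
rewrite mcoeffD mcoeffZ mcoeffMX; suff -> : (p' * q)@_(m1 + m2) = 0 by rewrite addr0.
apply: memN_msupp_eq0; apply/negP => /msuppM_le/allpairsP[[a b] /= [ap' bq e]].
have ne : a != m1.
  apply/eqP => ea; move: ap'; rewrite mcoeff_msupp ea /p' mcoeffB mcoeffZ mcoeffX eqxx.
  by rewrite mulr1 subrr eqxx.
have ap : a \in msupp p.
  move: ap'; rewrite !mcoeff_msupp /p' mcoeffB mcoeffZ mcoeffX [m1 == a]eq_sym (negPf ne).
  by rewrite mulr0 subr0.
have := congr1 key e; rewrite !keyD; have := hp _ ap ne; have := is_leadW lq bq.
by lia.
Qed.

End Leading.

(** * Highest weight vectors and interlacing of the leading row degrees *)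

Section HighestWeight.
Variables (K : numFieldType) (n : nat) (B : nat).

Local Notation P := {mpoly K[n * n]}.
Local Notation M := 'X_{1..n * n}.
Local Notation ix a j := (mxvec_index a j).

Definition restr (Q : pred M) (p : P) : P :=
  \sum_(m <- msupp p | Q m) p@_m *: 'X_[m].

Lemma mcoeff_restr Q p m : (restr Q p)@_m = if Q m then p@_m else 0.
Proof.
rewrite /restr raddf_sum /=.
under eq_bigr => k _ do rewrite mcoeffZ mcoeffX.
have [mp|mp] := boolP (m \in msupp p); last first.
  rewrite (memN_msupp_eq0 mp) if_same big_seq_cond big1 // => k /andP[kp _].
  by case: eqP => [e|_]; [rewrite -e kp in mp | rewrite mulr0].
rewrite big_mkcond (bigD1_seq m) ?msupp_uniq //= eqxx mulr1 big1 ?addr0 // => k ne.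
by rewrite (negPf ne) mulr0 if_same.
Qed.

Lemma restr_restr Q Q' p : {subset Q' <= Q} -> restr Q' (restr Q p) = restr Q' p.
Proof.
move=> sub; apply/mpolyP => m; rewrite !mcoeff_restr.
by case: ifP => // /sub; rewrite unfold_in => ->.
Qed.

Lemma polar_restr (J : pred 'I_n) a b Q p :
  (forall (m m' : M) j, J j -> (0 < m (ix a j))%N ->
     m' = (m - U_(ix a j) + U_(ix b j))%MM -> Q m' = Q m) ->
  polar J a b (restr Q p) = restr Q (polar J a b p).
Proof.
move=> inv; apply/mpolyP => m; rewrite mcoeff_restr !mcoeff_polar.
case: ifP => Qm; last first.
  by rewrite big1 // => j /andP[Jj h]; rewrite mcoeff_restr (inv m _ j) // Qm mul0rn.
by apply: eq_bigr => j /andP[Jj h]; rewrite mcoeff_restr (inv m _ j) // Qm.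
Qed.

Lemma polar1_comm (J : pred 'I_n) a b c d k (p : P) : ~~ J k ->
  polar J a b (polar (pred1 k) c d p) = polar (pred1 k) c d (polar J a b p).
Proof.
move=> Jk; rewrite /polar !big_pred1_eq raddf_sum [in RHS]mulr_sumr /=.
apply: eq_bigr => j Jj; have ne : k != j by apply: contraNneq Jk => ->.
rewrite !mderivM !mderiv_var [j == k]eq_sym (negPf ne) !andbF !mul0r !add0r.
by rewrite mderiv_comm; ring.
Qed.

(** Within one column the operator moves units from row [b] to row [a], so a monomial of the image
    has a single source; the derivatives contribute the positive factor [c]. *)
Lemma mcoeff_polar1_iter a b k i (p : P) (m : M) : a != b ->
  exists2 c : nat, (0 < c)%N &
  (iter i (polar (pred1 k) a b) p)@_(m + U_(ix a k) *+ i) =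
   c%:R * p@_(m + U_(ix b k) *+ i).
Proof.
move=> ab; have ne : ix a k != ix b k by rewrite mxvec_index_eq (negPf ab).
elim: i p m => [|i IH] p m; first by exists 1%N; rewrite ?mulm0n ?mul1r.
have [c c0 hc] := IH (polar (pred1 k) a b p) (m + U_(ix a k))%MM.
exists (c * (m (ix b k) + i).+1)%N; first by rewrite muln_gt0 c0.
rewrite iterSr mulmS addmA hc natrM -mulrA; congr (_ * _).
rewrite mcoeff_polar (big_pred1 k) => [|j] /=; last first.
  by case: eqP => // ->; rewrite !mnmDE mnm1E eqxx; lia.
rewrite -addmA [(U_(ix a k) + _)%MM]addmC addmA addmK -addmA -mulmSr mulr_natl; congr (_ *+ _.+1).
by rewrite mnmDE mulmnE mnm1E eqxx mul1n.
Qed.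

Lemma mcoeff_polar1_iter_eq0 a b k i (p : P) (m : M) : a != b ->
  (m (ix a k) < i)%N -> (iter i (polar (pred1 k) a b) p)@_m = 0.
Proof.
move=> ab; elim: i m => // i IH m lt.
rewrite iterS mcoeff_polar big1 // => j /andP[/eqP-> pos].
rewrite IH ?mul0rn // mnmDE mnmBE !mnm1E !mxvec_index_eq !eqxx eq_sym (negPf ab).
by rewrite andbT /=; lia.
Qed.

(** Highest weight for the action on rows, whereas the representation itself comes from the action
    on columns. With weight [lam], these vectors turn out to form exactly the Schur space. *)
Definition highest_weight (lam : 'I_n -> nat) (f : P) : Prop :=
  (forall a b : 'I_n, (a < b)%N -> polar predT a b f = 0) /\
  (forall m a, m \in msupp f -> rowdeg predT m a = lam a).

Section Lead.
Variables (lam : 'I_n -> nat) (f : P) (m : M).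
Hypothesis lam_B : forall a, (lam a < B)%N.
Hypothesis hw_f : highest_weight lam f.
Hypothesis lead_f : is_lead B f m.

Lemma highest_weight_small m' : m' \in msupp f -> small B m'.
Proof.
move=> m'f u; case/mxvec_indexP: u => a j; apply: leq_ltn_trans (lam_B a).
by rewrite -(hw_f.2 _ a m'f) /rowdeg (bigD1 j) //= leq_addr.
Qed.

Lemma lead_supp : m \in msupp f.
Proof. by rewrite mcoeff_msupp lead_f.1. Qed.

Let agree (k : nat) : pred M :=
  fun m' => [forall a, forall j : 'I_n, (j < k)%N ==> (m' (ix a j) == m (ix a j))].

Let agreeP k (m' : M) :
  reflect (forall a (j : 'I_n), (j < k)%N -> m' (ix a j) = m (ix a j)) (agree k m').
Proof.
apply: (iffP 'forall_forallP) => h a j; last by apply/implyP => /h ->.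
by move=> lt; have /implyP/(_ lt)/eqP := h a j.
Qed.

Let geJ (k : nat) : pred 'I_n := fun j => (k <= j)%N.

(** In the reading order of the variables, [m'] first departs from [m] at row [b] of column [k], and
    there it is larger; so it lies above the leading monomial. *)
Lemma mcoeff_above_lead (a b k : 'I_n) (m' : M) : (a < b)%N ->
  agree k m' -> (m (ix b k) < m' (ix b k))%N ->
  (forall c : 'I_n, (b < c)%N -> m' (ix c k) = m (ix c k)) -> f@_m' = 0.
Proof.
move=> ab /agreeP ag lt hc; apply: memN_msupp_eq0; apply/negP => m'f.
have := is_leadW lead_f m'f; rewrite leqNgt => /negP; apply.
apply: (@key_lt _ _ _ _ b k) => //; first exact/highest_weight_small/lead_supp.
  by move=> c j lt'; rewrite ag.
by move=> c lt'; rewrite hc.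
Qed.

Lemma polar_ge_split (k : 'I_n) a b (p : P) :
  polar (geJ k) a b p = polar (pred1 k) a b p + polar (geJ k.+1) a b p.
Proof.
rewrite /polar (bigD1 k) /geJ /= ?leqnn // big_pred1_eq; congr (_ + _).
by apply: eq_bigl => j; rewrite [RHS]ltn_neqAle -val_eqE /= eq_sym andbC.
Qed.

(** Columns are frozen one at a time. When column [k] is frozen, its share of the polarization could
    only come from monomials with one more unit in row [b] of that column, which lie above the
    leading one. *)
Lemma polar_agree_eq0 k (a b : 'I_n) : (a < b)%N -> (k <= n)%N ->
  polar (geJ k) a b (restr (agree k) f) = 0.
Proof.
move=> ab; elim: k => [_|k IH kn].
  rewrite polar_restr => [|m1 m2 j _ _ _]; last by apply/agreeP/agreeP.
  rewrite (_ : polar _ a b f = polar predT a b f) ?hw_f.1 //.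
  by apply/mpolyP => m'; rewrite mcoeff_restr mcoeff0 if_same.
pose k' := Ordinal kn; have {IH} := IH (ltnW kn).
rewrite -[k]/(val k') polar_ge_split => e0.
have sub : {subset agree k'.+1 <= agree k'}.
  by move=> m' /agreeP h; apply/agreeP => c j lt; apply: h; apply: ltnW.
rewrite -(restr_restr f sub) polar_restr => [|m1 m2 j Jj _ ->]; last first.
  have eq1 c (i : 'I_n) : (i < k'.+1)%N ->
      (m1 - U_(ix a j) + U_(ix b j))%MM (ix c i) = m1 (ix c i).
    move=> lt; have ne : j != i by apply: contraTneq Jj => ->; rewrite /geJ -ltnNge.
    by rewrite mnmDE mnmBE !mnm1E !mxvec_index_eq (negPf ne) !andbF subn0 addn0.
  by apply/agreeP/agreeP => h c i lt; have := h c i lt; rewrite eq1.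
move/eqP: e0; rewrite addrC addr_eq0 => /eqP->.
apply/mpolyP => m'; rewrite mcoeff_restr mcoeff0; case: ifP => // /agreeP ag.
rewrite mcoeffN mcoeff_polar big1 ?oppr0 // => j /andP[/eqP-> pos].
set m'' := (_ - _ + _)%MM; rewrite mcoeff_restr.
have m''E c i : m'' (ix c i) =
    (m' (ix c i) - ((a == c) && (k' == i)) + ((b == c) && (k' == i)))%N.
  by rewrite mnmDE mnmBE !mnm1E !mxvec_index_eq.
case: ifP => [ag''|]; last by rewrite mul0rn.
rewrite (@mcoeff_above_lead a b k') ?mul0rn //.
  rewrite m''E !eqxx /= -val_eqE /= (ltn_eqF ab) ag //=; lia.
move=> c bc; rewrite m''E -!val_eqE /= eqxx (ltn_eqF bc) (ltn_eqF (ltn_trans ab bc)).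
by rewrite subn0 addn0 ag.
Qed.

(** After freezing the columns before [k], the polarization [d] in column [k] and the polarization
    [E] in the later columns are opposite on [g]. A failure of interlacing would give a vector of
    too low weight killed by $E^{K_0+1}$ but not by $E^{K_0}$, against [polar_iter_eq0]. *)
Theorem lead_interlace (a b k : 'I_n) : (a < b)%N ->
  (rowdeg (geJ k) m b <= rowdeg (geJ k.+1) m a)%N.
Proof.
move=> ab; rewrite leqNgt; apply/negP => lt.
have neab : a != b by apply: contraTneq ab => ->; rewrite ltnn.
set K0 := m (ix b k).
pose g := restr (agree k) f.
pose d := polar (K := K) (pred1 k) a b.
pose E := polar (K := K) (geJ k.+1) a b.
have Eg : E g = - d g.
  have := polar_agree_eq0 ab (ltnW (ltn_ord k)); rewrite polar_ge_split.
  by move/eqP; rewrite addrC addr_eq0 => /eqP.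
have Ed p : E (d p) = d (E p) by rewrite /E /d polar1_comm // /geJ ltnn.
have EZ c p : E (c *: p) = c *: E p by rewrite /E linearZ.
have E0 : E 0 = 0 by rewrite /E linear0.
have dN p : d (- p) = - d p by rewrite /d raddfN.
have iterE i : iter i E g = (-1) ^+ i *: iter i d g.
  elim: i => [|i IH]; first by rewrite expr0 scale1r.
  rewrite iterS IH EZ exprSr -scalerA; congr (_ *: _).
  have -> : E (iter i d g) = iter i d (E g).
    by elim: i {IH} => //= i IH; rewrite Ed IH.
  rewrite Eg scaleN1r iterSr; elim: i {IH} => //= i ->; by rewrite dN.
(* Since [E + d] kills [g], the part [x] of [g] obtained by moving [K0] units of
   column [k] from row [b] to row [a] satisfies [E^K0 x = +- d^K0 (leading part)],
   which is nonzero and killed by [E]; the sl2 lemma bounds its weight. *)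
pose Q : pred M := fun m' => [&& agree k m', m' (ix a k) == (m (ix a k) + K0)%N,
  m' (ix b k) == 0%N &
  [forall c, (c != a) ==> (c != b) ==> (m' (ix c k) == m (ix c k))]].
have QE p : E (restr Q p) = restr Q (E p).
  rewrite /E polar_restr // => m1 m2 j Jj _ ->.
  have eq1 c (i : 'I_n) : (i < k.+1)%N ->
      (m1 - U_(ix a j) + U_(ix b j))%MM (ix c i) = m1 (ix c i).
    move=> lt1; have ne : j != i by apply: contraTneq Jj => ->; rewrite /geJ -ltnNge.
    by rewrite mnmDE mnmBE !mnm1E !mxvec_index_eq (negPf ne) !andbF subn0 addn0.
  rewrite /Q !eq1 //; congr [&& _, _, _ & _].
    apply/agreeP/agreeP => h c i lt1; have := h c i lt1; rewrite eq1 //; exact: ltnW.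
  by apply: eq_forallb => c; rewrite eq1.
pose x := restr Q g.
have iterQ i : iter i E x = restr Q (iter i E g).
  by elim: i => //= i ->; rewrite QE.
have xsupp m' : m' \in msupp x -> Q m' /\ m' \in msupp f.
  rewrite !mcoeff_msupp /x !mcoeff_restr.
  by case: (Q m') => //; [case: (agree k m') => //|]; rewrite eqxx.
have degE (m' : M) c : rowdeg predT m' c =
   (\sum_(j < n | (j < k)%N) m' (ix c j) + m' (ix c k) + rowdeg (geJ k.+1) m' c)%N.
  rewrite /rowdeg (bigID (fun j : 'I_n => (j < k)%N)) /= -addnA; congr (_ + _)%N.
  rewrite (bigD1 k) /= ?ltnn //; congr (_ + _)%N.
  apply: eq_bigl => j; rewrite /geJ -leqNgt [RHS]ltn_neqAle -val_eqE /= eq_sym.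
  by rewrite andbC.
have degk c : rowdeg (geJ k) m c = (m (ix c k) + rowdeg (geJ k.+1) m c)%N.
  rewrite /rowdeg (bigD1 k) /= /geJ ?leqnn //; congr (_ + _)%N.
  by apply: eq_bigl => j; rewrite [RHS]ltn_neqAle -val_eqE /= eq_sym andbC.
(* The total row degrees are fixed, so what column [k] gains in row [a] and loses in row [b] is
   compensated in the later columns. *)
have xdeg m' : m' \in msupp x ->
    (rowdeg (geJ k.+1) m' a + K0 = rowdeg (geJ k.+1) m a)%N /\
    (rowdeg (geJ k.+1) m' b = rowdeg (geJ k) m b)%N.
  case/xsupp => /and4P[/agreeP ag /eqP ea /eqP eb _] m'f.
  have e c : (\sum_(j < n | (j < k)%N) m' (ix c j) =
              \sum_(j < n | (j < k)%N) m (ix c j))%N.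
    by apply: eq_bigr => j /ag ->.
  have := hw_f.2 _ a m'f; rewrite -(hw_f.2 _ a lead_supp) !degE ea e.
  have := hw_f.2 _ b m'f; rewrite -(hw_f.2 _ b lead_supp) !degE eb e degk -/K0.
  by lia.
have EK0 : iter K0 E x != 0.
  have [m0 m0E] : exists m0 : M, m = (m0 + U_(ix b k) *+ K0)%MM.
    exists (m - U_(ix b k) *+ K0)%MM; rewrite submK //.
    apply/mnm_lepP => u; rewrite mulmnE mnm1E; case: eqP => [<-|//].
    by rewrite mul1n.
  (* This is [m] with its [K0] units moved from row [b] to row [a]; the coefficient there is a
     nonzero multiple of the leading coefficient. *)
  pose m1 := (m0 + U_(ix a k) *+ K0)%MM.
  have [c c0 hc] := mcoeff_polar1_iter k K0 g m0 neab.
  have Qm1 : Q m1.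
    have mm1 u j : (m1 (ix u j) + ((b == u) && (k == j)) * K0 =
       m (ix u j) + ((a == u) && (k == j)) * K0)%N.
      by rewrite m0E !mnmDE !mulmnE !mnm1E !mxvec_index_eq addnAC.
    apply/and4P; split.
    - apply/agreeP => u j lt1; have := mm1 u j.
      have /negPf-> : k != j by apply: contraTneq lt1 => ->; rewrite ltnn.
      by rewrite !andbF !mul0n !addn0.
    - have := mm1 a k; rewrite !eqxx eq_sym (negPf neab) /= mul1n mul0n addn0.
      by move/eqP.
    - have := mm1 b k; rewrite !eqxx (negPf neab) /= mul1n mul0n addn0 -/K0.
      by apply: contra_eqT; lia.
    apply/forallP => u; apply/implyP => ua; apply/implyP => ub.
    have := mm1 u k; rewrite eq_sym (negPf ub) eq_sym (negPf ua) !mul0n !addn0.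
    by move/eqP.
  apply: contraTneq isT => /(congr1 (mcoeff m1)).
  rewrite iterQ mcoeff_restr Qm1 iterE mcoeffZ mcoeff0 hc -m0E.
  move/eqP; rewrite mulf_eq0 signr_eq0 mulf_eq0 pnatr_eq0 /=.
  rewrite /g mcoeff_restr (introT (agreeP _ _)) // (negPf lead_f.1) orbF.
  by case: c c0 {hc}.
(* One more application would need a monomial of [g] with [K0 + 1] units in row [b] of column [k],
   which lies above the leading one. *)
have EK1 : iter K0.+1 E x = 0.
  rewrite iterQ iterE; apply/mpolyP => m'; rewrite mcoeff_restr mcoeff0.
  case: ifP => // /and4P[/agreeP ag /eqP ea /eqP eb /forallP ec].
  rewrite mcoeffZ.
  have [ge|lt1] := leqP K0.+1 (m' (ix a k)); last first.
    by rewrite mcoeff_polar1_iter_eq0 ?mulr0.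
  pose m0 := (m' - U_(ix a k) *+ K0.+1)%MM.
  have m'E : m' = (m0 + U_(ix a k) *+ K0.+1)%MM.
    rewrite submK //.
    apply/mnm_lepP => u; rewrite mulmnE mnm1E; case: eqP => [<-|//].
    by rewrite mul1n.
  have [c _ hc] := mcoeff_polar1_iter k K0.+1 g m0 neab.
  rewrite m'E hc /g mcoeff_restr; case: ifP => [ag0|]; last by rewrite !mulr0.
  rewrite (@mcoeff_above_lead a b k) ?mulr0 //.
    by rewrite mnmDE mulmnE mnm1E eqxx mul1n -/K0; lia.
  move=> u bu; have ua : (u == a) = false by apply/eqP => e; rewrite e in bu; lia.
  have ub : (u == b) = false by apply/eqP => e; rewrite e in bu; lia.
  have := ec u; rewrite ua ub /= => /eqP <-.
  rewrite m'E !mnmDE !mulmnE !mnm1E !mxvec_index_eq.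
  by rewrite ![_ == u]eq_sym ua ub !andFb !mul0n.
have [x0|nx] := eqVneq x 0.
  case/eqP: EK0; rewrite x0; suff it i : iter i E 0 = 0 by rewrite it.
  by elim: i => //= i ->.
have [m' m'x] : exists m', m' \in msupp x.
  case e: (msupp x) => [|m' s]; last by exists m'; rewrite mem_head.
  by case/eqP: nx; rewrite (mpolyE x) e big_nil.
have [ha hb] := xdeg _ m'x.
case/eqP: EK0.
apply: (@polar_iter_eq0 _ _ _ _ _ neab (rowdeg (geJ k.+1) m' a) (rowdeg (geJ k) m b)) => //.
- apply/polar_diag_eigen => m2 /xdeg[h1 _]; lia.
- by apply/polar_diag_eigen => m2 /xdeg[_ h1].
lia.
Qed.

End Lead.
End HighestWeight.

(** * Minors *)

Section DerivationDet.
Variables (P : comNzRingType) (D : {additive P -> P}).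
Hypothesis DM : forall p q, D (p * q) = D p * q + p * D q.

Lemma derivation1 : D 1 = 0.
Proof.
by have := DM 1 1; rewrite !mulr1 mul1r => /eqP; rewrite addrC -subr_eq subrr eq_sym => /eqP.
Qed.

Lemma derivation_det_eq0 k (A : 'M[P]_k) :
  (forall i j, D (A i j) = 0) -> D (\det A) = 0.
Proof.
move=> h; rewrite /determinant raddf_sum big1 // => s _.
have prod0 : D (\prod_i A i (s i)) = 0.
  elim/big_ind: _ => [|x y ex ey|i _]; [exact: derivation1 | | exact: h].
  by rewrite DM ex ey mul0r mulr0 addr0.
rewrite DM prod0 mulr0 addr0; suff -> : D ((-1) ^+ s) = 0 by rewrite mul0r.
by case: (s : bool); rewrite ?expr1 ?raddfN /= derivation1 ?oppr0.
Qed.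

Lemma derivation_cofactor_eq0 k (A : 'M[P]_k) i0 j0 :
  (forall i j, i != i0 -> D (A i j) = 0) -> D (cofactor A i0 j0) = 0.
Proof.
move=> h; rewrite /cofactor DM derivation_det_eq0 ?mulr0 ?addr0.
  suff -> e : D ((-1) ^+ e) = 0 by rewrite mul0r.
  by rewrite -signr_odd; case: odd; rewrite ?expr1 ?raddfN /= derivation1 ?oppr0.
by move=> i j; rewrite !mxE; apply: h; rewrite eq_sym neq_lift.
Qed.

End DerivationDet.

Section MinorWeights.
Variables (K : numFieldType) (n : nat).

Local Notation P := {mpoly K[n * n]}.
Local Notation M := 'X_{1..n * n}.
Local Notation ix a j := (mxvec_index a j).
Local Notation z a j := ('X_(mxvec_index a j) : P).

(** Expanding along row [b], the polarization replaces that row by row [a], which gives an entry of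
    the matrix times its adjugate. If row [b] is outside the minor, every entry is killed. *)
Lemma polar_minor (J : {set 'I_n}) (a b : 'I_n) : (a <= b)%N ->
  polar predT a b (minor K J) = if (a == b) && (a < #|J|)%N then minor K J else 0.
Proof.
move=> ab; rewrite /minor; set A := (\matrix_(i, j) _).
have AE i j : A i j = z (widen_ord (card_set_ord J) i) (enum_val j) by rewrite !mxE.
have polarA i j : polar predT a b (A i j) =
    if widen_ord (card_set_ord J) i == b then z a (enum_val j) else 0.
  by rewrite AE polar_var.
have [bJ|Jb] := ltnP b #|J|; last first.
  rewrite (derivation_det_eq0 (polarM _ _ _)) => [|i j].
    by case: eqP => [->|] //=; rewrite ltnNge Jb.
  by rewrite /= polarA -val_eqE /= ltn_eqF // (leq_trans (ltn_ord i)).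
have aJ := leq_ltn_trans ab bJ; rewrite aJ andbT.
pose a' := Ordinal aJ; pose b' := Ordinal bJ.
rewrite [in LHS](expand_det_row A b') raddf_sum /=.
under eq_bigr => j _.
  rewrite polarM polarA (derivation_cofactor_eq0 (polarM _ _ _)); last first.
    by move=> i k; rewrite -val_eqE /= => ne; rewrite /= polarA -val_eqE /= (negPf ne).
  rewrite -val_eqE /= eqxx mulr0 addr0.
  over.
have := congr1 (fun B : 'M_ _ => B a' b') (mul_mx_adj A).
rewrite [in LHS]mxE [in RHS]mxE -val_eqE /=.
move=> e; rewrite (_ : (if a == b then \det A else 0) = \det A *+ (a == b)).
  rewrite -e; apply: eq_bigr => j _; rewrite AE mxE.
  by congr ('X_(ix _ _) * _); apply: val_inj.
by case: eqP.
Qed.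

(** The derivative of the minor by a variable of a column outside [J] is zero, and in characteristic
    zero this excludes the variable. *)
Lemma minor_var_in (J : {set 'I_n}) m (a j : 'I_n) :
  m \in msupp (minor K J) -> (0 < m (ix a j))%N -> j \in J.
Proof.
move=> mJ pos; apply: contraTT mJ => jJ; rewrite -mcoeff_eq0.
have : mderiv (ix a j) (minor K J) = 0.
  rewrite /minor (derivation_det_eq0 (mderivM _)) // => i k.
  rewrite !mxE /= mderiv_var; case: eqP => //= _; case: eqP => // e.
  by case/negP: jJ; rewrite -e enum_valP.
move/(congr1 (mcoeff (m - U_(ix a j))%MM)); rewrite mcoeff_deriv mcoeff0.
rewrite submK ?lep1mP -?lt0n // => /eqP; rewrite -mulr_natl mulf_eq0 pnatr_eq0 /=.
by [].
Qed.

Lemma minor_neq0 (J : {set 'I_n}) : minor K J != 0.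
Proof.
(* At this 0/1 matrix the submatrix defining the minor becomes the identity. *)
pose c := \matrix_(i < n, j < n)
  ([exists k : 'I_#|J|, (val k == val i) && (enum_val k == j)]%:R : K).
pose v u := mxvec c 0 u.
apply: contra_neqN (oner_neq0 K) => /eqP /(congr1 (meval v)).
rewrite meval0 /minor -det_map_mx => <-.
rewrite (_ : map_mx _ _ = 1%:M) ?det1 //; apply/matrixP => i j.
rewrite !mxE /= mevalXU /v mxvecE mxE; congr ((nat_of_bool _)%:R : K).
apply/existsP/eqP => [[k /andP[/eqP/val_inj-> /eqP/enum_val_inj->]] //|->].
by exists j; rewrite !eqxx.
Qed.

End MinorWeights.

(** * Weights and leading monomials of minors *)

Section MinorLead.
Variables (K : numFieldType) (n : nat).

Local Notation P := {mpoly K[n * n]}.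
Local Notation M := 'X_{1..n * n}.
Local Notation ix a j := (mxvec_index a j).

(** A uniform eigenvalue form of the definition, from which stability under linear combinations and
    products is immediate. *)
Lemma highest_weightP (lam : 'I_n -> nat) (f : P) :
  highest_weight lam f <->
  forall a b : 'I_n, (a <= b)%N ->
     polar predT a b f = (if a == b then (lam a)%:R else 0) *: f.
Proof.
split=> [[h1 h2] a b ab|h].
  have [<-|ne] := eqVneq a b.
    by apply/polar_diag_eigen => m; apply: h2.
  by rewrite h1 ?scale0r // ltn_neqAle ab andbT.
split=> [a b ab|m a].
  by rewrite h 1?ltnW // -val_eqE /= (ltn_eqF ab) scale0r.
by move: m; apply/polar_diag_eigen; rewrite h // eqxx.
Qed.

Lemma highest_weightZD (lam : 'I_n -> nat) (c : K) (f g : P) :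
  highest_weight lam f -> highest_weight lam g -> highest_weight lam (c *: f + g).
Proof.
move=> /highest_weightP hf /highest_weightP hg; apply/highest_weightP => a b ab.
by rewrite linearP /= hf // hg // scalerDr !scalerA [c * _]mulrC.
Qed.

Lemma eq_highest_weight (la mu : 'I_n -> nat) (f : P) :
  la =1 mu -> highest_weight la f -> highest_weight mu f.
Proof. by move=> e [h1 h2]; split=> // m a /h2 ->. Qed.

Lemma highest_weight0 (lam : 'I_n -> nat) : highest_weight lam (0 : P).
Proof. by apply/highest_weightP => a b _; rewrite linear0 scaler0. Qed.

Lemma highest_weightM (la mu : 'I_n -> nat) (f g : P) :
  highest_weight la f -> highest_weight mu g ->
  highest_weight (fun a => la a + mu a)%N (f * g).
Proof.
move=> /highest_weightP hf /highest_weightP hg; apply/highest_weightP => a b ab.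
rewrite polarM hf // hg // -scalerAl -scalerAr -scalerDl.
by case: eqP => _; rewrite ?natrD ?addr0.
Qed.

Lemma highest_weight1 : highest_weight (fun _ => 0%N) (1 : P).
Proof.
apply/highest_weightP => a b _; rewrite if_same scale0r.
exact: derivation1 (polarM _ _ _).
Qed.

Lemma highest_weight_prod (I : Type) (r : seq I) (la : I -> 'I_n -> nat) (f : I -> P) :
  (forall i, highest_weight (la i) (f i)) ->
  highest_weight (fun a => \sum_(i <- r) la i a)%N (\prod_(i <- r) f i).
Proof.
move=> h; elim: r => [|i r IH].
  rewrite big_nil; apply: eq_highest_weight highest_weight1 => a.
  by rewrite big_nil.
rewrite big_cons; apply: eq_highest_weight (highest_weightM (h i) IH) => a.
by rewrite big_cons.
Qed.

Lemma minor_highest_weight (J : {set 'I_n}) :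
  highest_weight (fun a => (a < #|J|)%N : nat) (minor K J).
Proof.
apply/highest_weightP => a b ab; rewrite polar_minor //.
by case: eqP => _ /=; rewrite ?scale0r //; case: ltnP; rewrite ?scale1r ?scale0r.
Qed.

(** For a strictly decreasing row [r] this is the antidiagonal term of the minor on the columns in
    [r]. *)
Definition row_mnm (r : seq 'I_n) : M :=
  [multinom mxvec (\matrix_(a < n, j < n) nat_of_bool (onth r a == Some j)) ord0 u
  | u < n * n].

Lemma row_mnmE r a j : row_mnm r (ix a j) = (onth r a == Some j).
Proof. by rewrite mnmE mxvecE mxE. Qed.

Lemma rowdeg_gt0P (J : pred 'I_n) (m : M) a :
  reflect (exists2 j, J j & (0 < m (ix a j))%N) (0 < rowdeg J m a)%N.
Proof.
rewrite lt0n /rowdeg sum_nat_eq0 negb_forall.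
apply: (iffP existsP) => [[j]|[j Jj pos]].
  by rewrite negb_imply -lt0n => /andP[]; exists j.
by exists j; rewrite negb_imply Jj -lt0n.
Qed.

(* Interlacing leaves only one candidate for the leading monomial: the row
   indices must be matched with the column indices in decreasing order. *)
Lemma minor_lead B (r : seq 'I_n) : (1 < B)%N ->
  sorted (fun x y : 'I_n => (y < x)%N) r ->
  is_lead B (minor K [set x in r]) (row_mnm r).
Proof.
move=> B1 sr; set J := [set x in r].
have gt_trans : transitive (fun x y : 'I_n => (y < x)%N).
  by move=> x y w /= h1 h2; apply: ltn_trans h2 h1.
have gt_irr : irreflexive (fun x y : 'I_n => (y < x)%N) by move=> x /=; rewrite ltnn.
have ur : uniq r by apply: sorted_uniq sr.
have cJ : #|J| = size r by rewrite cardsE; apply/card_uniqP.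
have hw := minor_highest_weight J.
have wB (a : 'I_n) : ((a < #|J|)%N < B)%N by apply: leq_ltn_trans B1; case: (_ < _)%N.
have [m lm] := ex_lead (minor_neq0 K J) (highest_weight_small wB hw).
suff -> : row_mnm r = m by [].
have inter := lead_interlace wB hw lm.
have mJ := lead_supp lm.
have deg a := hw.2 _ a mJ.
have uniq_a (a i j : 'I_n) : (0 < m (ix a i))%N -> (0 < m (ix a j))%N -> i = j.
  move=> hi hj; apply/eqP; apply: contraT => ne.
  have := deg a; rewrite /rowdeg (bigD1 i) //= (bigD1 j) /=; last by rewrite eq_sym.
  by case: (_ < _)%N; lia.
have le1 (a i : 'I_n) : (m (ix a i) <= 1)%N.
  have := deg a; rewrite /rowdeg (bigD1 i) //=.
  by case: (_ < _)%N; lia.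
have ex_a (a : 'I_n) : (a < #|J|)%N -> exists j, (0 < m (ix a j))%N.
  move=> lt; have /rowdeg_gt0P[j _ pos] : (0 < rowdeg predT m a)%N.
    by rewrite deg lt.
  by exists j.
apply/mnmP => u; case/mxvec_indexP: u => a0 j0; rewrite row_mnmE.
pose col i := odflt a0 [pick j | (0 < m (ix (insubd a0 i) j))%N].
have Jn : (#|J| <= n)%N := card_set_ord J.
have colP (a : 'I_n) : (a < #|J|)%N -> (0 < m (ix a (col a)))%N.
  move=> lt; rewrite /col; have -> : insubd a0 (val a) = a by apply: valKd.
  by case: pickP => //= h; have [j] := ex_a a lt; rewrite h.
pose s := mkseq col #|J|.
have ss : sorted (fun x y : 'I_n => (y < x)%N) s.
  apply/(sortedP a0) => i; rewrite size_mkseq => lt.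
  rewrite !nth_mkseq //; last exact: ltnW.
  have an : (i < n)%N by apply: leq_trans Jn; apply: ltnW.
  have bn : (i.+1 < n)%N by apply: leq_trans Jn.
  have ha := colP (Ordinal an) (ltnW lt); have hb := colP (Ordinal bn) lt.
  (* The variable of row [i + 1] counts in the columns from [col i.+1] on, so interlacing puts the
     variable of row [i] strictly to the right of it. *)
  have := inter (Ordinal an) (Ordinal bn) (col i.+1) (ltnSn _).
  have : (0 < rowdeg (fun j : 'I_n => col i.+1 <= j)%N m (Ordinal bn))%N.
    by apply/rowdeg_gt0P; exists (col i.+1).
  move=> pos /(leq_trans pos)/rowdeg_gt0P[j lj hj].
  by rewrite (uniq_a _ _ _ ha hj).
have us : uniq s by apply: sorted_uniq ss.
have sub : {subset s <= r}.
  move=> j /(nthP a0)[ i]; rewrite size_mkseq => lt; rewrite nth_mkseq // => <-.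
  have an : (i < n)%N by apply: leq_trans Jn.
  by have := minor_var_in mJ (colP (Ordinal an) lt); rewrite inE.
(* Equal sizes make the inclusion of [s] in [r] an equality of sets; two strictly decreasing lists
   of the same set coincide. *)
have [_ mem] := uniq_min_size us sub (eq_leq (etrans (esym cJ) (esym (size_mkseq col _)))).
rewrite (irr_sorted_eq gt_trans gt_irr sr ss (fun x => esym (mem x))).
rewrite onthE (_ : map Some s = mkseq (Some \o col) #|J|); last by rewrite /s /mkseq -map_comp.
have [lt|ge] := ltnP a0 #|J|; last first.
  rewrite nth_default ?size_mkseq //=.
  apply/esym/eqP; rewrite -leqn0 leqNgt; apply/negP => pos.
  have : (0 < rowdeg predT m a0)%N by apply/rowdeg_gt0P; exists j0.
  by rewrite deg (ltnNge a0) ge.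
rewrite nth_mkseq //=; have := colP _ lt; have := le1 a0 j0.
have [e|ne] := eqVneq (Some (col a0)) (Some j0).
  by case: e => -> /=; lia.
move=> _ pos; apply/esym/eqP; rewrite -leqn0 leqNgt; apply/negP => pos'.
by move/eqP: ne; apply; rewrite (uniq_a _ _ _ pos pos').
Qed.

End MinorLead.

(** * The basis *)

Section Span.
Variables (K : fieldType) (V : lmodType K) (I : eqType).
Variables (Q : I -> Prop) (v : I -> V).

Lemma span0 : Defs.span Q v 0.
Proof. by exists [::], (fun _ => 0); split=> //; rewrite big_nil. Qed.

Lemma span_uniq x : Defs.span Q v x ->
  exists (s : seq I) (c : I -> K),
    [/\ uniq s, forall i, i \in s -> Q i & x = \sum_(i <- s) c i *: v i].
Proof.
case=> s [c [sQ ->]]; exists (undup s), (fun i => c i *+ count_mem i s).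
split=> [|i|]; [exact: undup_uniq | by rewrite mem_undup => /sQ |].
rewrite -big_undup_iterop_count; apply: eq_bigr => i _.
by rewrite -scalerMnl.
Qed.

Lemma span_scaleD c i x : Q i -> Defs.span Q v x -> Defs.span Q v (c *: v i + x).
Proof.
move=> Qi /span_uniq[s [a [us sQ ->]]].
have [is_|nis] := boolP (i \in s).
  exists s, (fun k => if k == i then c + a i else a k); split=> //.
  rewrite !(bigD1_seq i is_ us) /= eqxx scalerDl addrA; congr (_ + _).
  by apply: eq_bigr => k /negPf->.
exists (i :: s), (fun k => if k == i then c else a k); split=> [k|].
  by rewrite inE => /predU1P[->//|/sQ].
rewrite big_cons eqxx; congr (_ + _); rewrite !big_seq; apply: eq_bigr => k ks.
by case: eqP => // e; rewrite -e ks in nis.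
Qed.

End Span.

(** * Linear independence from distinct leading monomials *)

Section LeadIndep.
Variables (K : numFieldType) (n B : nat).
Local Notation P := {mpoly K[n * n]}.
Local Notation M := 'X_{1..n * n}.

Lemma is_lead1 : is_lead B (1 : P) 0%MM.
Proof.
split; first by rewrite mcoeff1 eqxx oner_neq0.
by move=> m; rewrite mcoeff_msupp mcoeff1; have [->|_] := eqVneq m 0%MM; rewrite ?eqxx.
Qed.

(** Descending induction on the key of [mu i]: any other member containing the monomial [mu i] has a
    larger leading key, so its coefficient is already known to vanish. *)
Lemma lead_indep (I : eqType) (v : I -> P) (mu : I -> M) (s : seq I) (c : I -> K) :
  uniq s -> (forall i, i \in s -> is_lead B (v i) (mu i)) ->
  {in s &, injective mu} ->
  \sum_(i <- s) c i *: v i = 0 -> forall i, i \in s -> c i = 0.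
Proof.
move=> us lead inj e i is_; pose b := (\max_(i <- s) key B (mu i))%N.
have [d] := ubnP (b - key B (mu i)); elim: d i is_ => // d IH i is_ lt.
have := congr1 (mcoeff (mu i)) e; rewrite mcoeff0 raddf_sum /= (bigD1_seq i) //=.
rewrite big_seq_cond big1 ?addr0 => [|k /andP[ks ne]].
  by rewrite mcoeffZ => /eqP; rewrite mulf_eq0 (negPf (lead i is_).1) orbF => /eqP.
have [z|nz] := eqVneq ((v k)@_(mu i)) 0; first by rewrite mcoeffZ z mulr0.
rewrite IH ?scale0r ?mcoeff0 //.
have kb : (key B (mu k) <= b)%N by apply: (@leq_bigmax_seq _ s xpredT (fun i => key B (mu i))).
have : (key B (mu i) < key B (mu k))%N.
  apply: (lead k ks).2; first by rewrite mcoeff_msupp.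
  by apply: contraNneq ne => /inj-> //.
by lia.
Qed.

End LeadIndep.

(** * Tableaux as fillings, and weights of the Schur space *)

Section Assembly.
Variables (K : numFieldType) (n : nat) (lam : seq nat).
Hypothesis part_lam : is_partition lam.
Local Notation P := {mpoly K[n * n]}.
Local Notation M := 'X_{1..n * n}.
Local Notation ix a j := (mxvec_index a j).
Local Notation wt := (fun a : 'I_n => nth 0%N lam a).

Lemma pmap_onth_iota (T : Type) (r : seq T) N : (size r <= N)%N ->
  pmap (onth r) (iota 0 N) = r.
Proof.
elim: N r => [|N IH] [|x r] //= lt.
  by elim: (iota 1 N) => //= k s ->; rewrite onth0n.
congr cons; rewrite -[in RHS](IH r) //.
by rewrite (iotaDl 1 0 N); elim: (iota 0 N) => //= k s ->.
Qed.

Lemma row_uniq (r : seq 'I_n) : sorted (fun x y : 'I_n => (y < x)%N) r -> uniq r.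
Proof.
apply: sorted_uniq => [x y w /= h1 h2|x /=]; [exact: ltn_trans h2 h1 | exact: ltnn].
Qed.

(** Sort the rows of [Y] by decreasing length and make them the columns of [F]; the condition on the
    shape says that the rows of [F] then have the lengths in [lam]. *)
Lemma RSCT_filling (Y : seq (seq 'I_n)) :
  all (sorted (fun x y : 'I_n => y < x)%N) Y -> all (leq 1) (shape Y) ->
  transpose (sort_parts (shape Y)) = lam ->
  exists2 F, is_filling lam F & Delta_filling K lam F = Delta_RSCT K Y.
Proof.
move=> rows pos /(transpose_sortP _ part_lam) h.
pose L := sort (fun r r' : seq 'I_n => size r' <= size r)%N Y.
have pL : perm_eq L Y by rewrite perm_sort.
have sL : sorted (fun r r' : seq 'I_n => size r' <= size r)%N L.
  by apply: sort_sorted => r r'; apply: leq_total.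
have colL k c : onth (column L k) c = onth (nth [::] L c) k.
  apply: onth_column => i j lt; apply: leq_trans.
  have [jL|ge] := ltnP j (size L); last by rewrite (nth_default _ ge).
  have := @sorted_ltn_nth _ (fun r r' : seq 'I_n => size r' <= size r)%N _ [::] L sL i j.
  rewrite !inE jL (ltn_trans lt jL) lt; apply=> //.
  by move=> x y w /= h1 h2; apply: leq_trans h2 h1.
have size_row r : r \in L -> (size r <= size lam)%N.
  rewrite (perm_mem pL) => rY; rewrite leqNgt; apply/negP => lt.
  have := h (size lam); rewrite nth_default // => /eqP; apply/negP.
  by rewrite -lt0n -has_count; apply/hasP; exists (size r) => //; apply: map_f.
pose F := mkseq (column L) (size lam).
have colF c : (c < size L)%N -> column F c = nth [::] L c.
  move=> lt; rewrite -[RHS](pmap_onth_iota (N := size lam)); last exact/size_row/mem_nth.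
  rewrite /column /F /mkseq; elim: (iota 0 _) => //= k s ->.
  by rewrite colL.
exists F.
  rewrite /is_filling /shape; apply: (eq_from_nth (x0 := 0%N)).
    by rewrite size_map size_mkseq.
  move=> k; rewrite size_map size_mkseq => lt.
  rewrite (nth_map [::]) ?size_mkseq // nth_mkseq // (perm_size (perm_column k pL)).
  by rewrite size_column h.
have hd : head 0%N lam = size L.
  rewrite -nth0 -h (perm_size pL) -(size_map size Y).
  by apply/eqP; rewrite -all_count.
rewrite /Delta_filling hd /Delta_RSCT -(perm_big _ pL) /= (big_nth [::]) big_mkord.
apply: eq_bigr => c _; rewrite colF // /minor_list row_uniq //.
by apply: (allP rows); rewrite -(perm_mem pL) mem_nth.
Qed.

Lemma nth_le_head a : (nth 0 lam a <= head 0 lam)%N.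
Proof.
case/andP: part_lam => sl _; rewrite leqNgt -(conjugate_lt a (head 0%N lam) sl).
apply/negP => lt; have : (0 < count (fun x => head 0%N lam < x)%N lam)%N by lia.
by rewrite conjugate_lt // nth0 ltnn.
Qed.

(** The weight at [a] counts the columns of the diagram longer than [a], which gives the part of
    [lam] at [a]. A column with a repetition gives 0, which has every weight. *)
Lemma filling_highest_weight (F : seq (seq 'I_n)) : is_filling lam F ->
  highest_weight wt (Delta_filling K lam F).
Proof.
move=> shF; case/andP: (part_lam) => sl _.
rewrite /Delta_filling.
apply: (eq_highest_weight (la := fun a : 'I_n =>
  (\sum_(c < head 0 lam) (a < size (column F c)))%N)).
  move=> a; rewrite (eq_bigr (fun c : 'I_(head 0%N lam) => (c < nth 0 lam a)%N : nat)).
    suff e h : (\sum_(c < h) (c < nth 0 lam a) = minn h (nth 0 lam a))%N.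
      by rewrite e; apply/minn_idPr/nth_le_head.
    elim: h => [|h IH]; rewrite ?big_ord0 ?min0n // big_ord_recr /= IH.
    by case: ltnP; lia.
  by move=> c _; rewrite size_column shF conjugate_lt.
apply: highest_weight_prod => c; rewrite /minor_list.
case: ifP => u; last exact: highest_weight0.
apply: eq_highest_weight (minor_highest_weight K _) => a.
by congr (nat_of_bool (_ < _)%N); rewrite cardsE; apply/card_uniqP.
Qed.

Lemma schur_highest_weight x : schur_space lam x -> highest_weight wt (x : P).
Proof.
case=> s [c [sF ->]]; elim: s sF => [|F s IH] sF.
  by rewrite big_nil; apply: highest_weight0.
rewrite big_cons; apply: highest_weightZD.
  by apply: filling_highest_weight; apply: sF; rewrite mem_head.
by apply: IH => i hi; apply: sF; rewrite inE hi orbT.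
Qed.

End Assembly.

(** * Leading monomials of tableaux and the basis theorem *)

Section Main.
Variables (K : numFieldType) (n : nat) (lam : seq nat).
Hypothesis part_lam : is_partition lam.
Hypothesis size_lam : (size lam <= n)%N.
Local Notation P := {mpoly K[n * n]}.
Local Notation M := 'X_{1..n * n}.
Local Notation ix a j := (mxvec_index a j).
Local Notation wt := (fun a : 'I_n => nth 0%N lam a).
Local Notation rsct := (fun Y : seq (seq 'I_n) =>
  exists2 alpha : seq nat, in_Z n lam alpha & is_RSCT alpha Y).

Definition tableau_mnm (Y : seq (seq 'I_n)) : M := (\sum_(r <- Y) row_mnm r)%MM.

Lemma tableau_mnmE Y a j : tableau_mnm Y (ix a j) = count_mem j (column Y a).
Proof.
rewrite /tableau_mnm mnm_sumE count_mem_column -sum1_count [RHS]big_mkcond.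
by apply: eq_bigr => r _; rewrite row_mnmE; case: eqP.
Qed.

Lemma tableau_lead B (Y : seq (seq 'I_n)) : (1 < B)%N ->
  all (sorted (fun x y : 'I_n => y < x)%N) Y ->
  is_lead B (Delta_RSCT K Y) (tableau_mnm Y).
Proof.
move=> B1; rewrite /Delta_RSCT /tableau_mnm; elim: Y => [|r Y IH] /=.
  by rewrite !big_nil => _; apply: is_lead1.
by case/andP=> sr /IH lY; rewrite !big_cons; apply: is_leadM (minor_lead K B1 sr) lY.
Qed.

Lemma in_Z_shape Y : rsct Y -> [/\ in_Z n lam (shape Y), is_RSCT (shape Y) Y,
  all (sorted (fun x y : 'I_n => y < x)%N) Y & all (leq 1) (shape Y)].
Proof.
case=> al zal hY; have e : shape Y = al by case: hY.
rewrite e; split=> //; first by case: hY.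
by case: zal => /allP h _; apply/allP => x /h /andP[].
Qed.

(** The exponents give the contents of columns 0 to [n - 1]; all later columns are empty because the
    parts of the shape are at most [n]. *)
Lemma tableau_mnm_inj (Y Y' : seq (seq 'I_n)) :
  rsct Y -> rsct Y' -> tableau_mnm Y = tableau_mnm Y' -> Y = Y'.
Proof.
move=> /in_Z_shape[[cY _] hY _ pY] /in_Z_shape[[cY' _] hY' _ pY'] e.
have col_big (X : seq (seq 'I_n)) k : is_composition n (shape X) -> (n <= k)%N ->
    column X k = [::].
  move=> /allP cX nk; apply: size0nil; rewrite size_column; apply/eqP.
  rewrite -leqn0 leqNgt -has_count; apply/hasPn => x /cX; lia.
apply: RSCT_inj pY pY' hY hY' _ => k.
have [lt|ge] := ltnP k n; last by rewrite !col_big.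
apply/allP => j _; apply/eqP.
by rewrite -[k]/(val (Ordinal lt)) -!tableau_mnmE e.
Qed.

(** A base exceeding every row degree, so that all monomials of weight [lam] are small, and
    exceeding 1, as [minor_lead] requires. *)
Let B := (sumn lam).+2.

Let wt_B (a : 'I_n) : (nth 0 lam a < B)%N.
Proof.
rewrite /B; apply: leq_trans (leqnSn _); rewrite ltnS.
elim: lam (nat_of_ord a) => [|x s IH] [|k] //=; first by rewrite leq_addr.
exact: leq_trans (IH k) (leq_addl _ _).
Qed.

Lemma RSCT_in_schur Y : rsct Y ->
  exists2 F, is_filling lam F & Delta_filling K lam F = Delta_RSCT K Y.
Proof.
by case/in_Z_shape => -[_ zY] _ sY pY; apply: RSCT_filling.
Qed.

(** Read the exponents in row [k] of variables as the content of column [k]: interlacing of the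
    leading monomial is what [RSCT_exists] asks for, and the row degrees give the shape. *)
Lemma lead_is_tableau (x : P) m : highest_weight wt x -> is_lead B x m ->
  exists2 Y, rsct Y & tableau_mnm Y = m.
Proof.
move=> hw lx; have inter := lead_interlace wt_B hw lx.
have deg (a : 'I_n) := hw.2 _ a (lead_supp lx).
pose col k := if insub k is Some a then
  flatten [seq nseq (m (ix a j)) j | j <- enum 'I_n] else [::].
have countE (a : 'I_n) (Q : pred 'I_n) : count Q (col a) = rowdeg Q m a.
  rewrite /col valK count_flatten sumnE 2!big_map big_enum /= /rowdeg [RHS]big_mkcond.
  by apply: eq_bigr => j _; rewrite count_nseq; case: (Q j); rewrite ?mul1n.
have col_end k : (n <= k)%N -> col k = [::].
  by move=> le; rewrite /col insubF // ltnNge le.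
have col_inter k t : (count (fun x : 'I_n => t <= x) (col k.+1) <=
                      count (fun x : 'I_n => t < x) (col k))%N.
  have [kn|nk] := ltnP k.+1 n; last by rewrite (col_end k.+1).
  have [tn|nt] := ltnP t n; last first.
    by rewrite (eq_count (a2 := pred0)) ?count_pred0 // => j /=; have := ltn_ord j; lia.
  have := inter (Ordinal (ltnW kn)) (Ordinal kn) (Ordinal tn) (ltnSn k).
  by rewrite -!countE.
have [Y [hY pY colY]] := RSCT_exists col_inter col_end.
have cY : in_Z n lam (shape Y).
  split; last first.
    apply/transpose_sortP => // k; rewrite -size_column (perm_size (colY k)).
    have [lt|ge] := ltnP k n; last by rewrite col_end // nth_default // (leq_trans size_lam).
    rewrite -[RHS](deg (Ordinal lt)) -countE -[k in LHS]/(val (Ordinal lt)).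
    by rewrite count_predT.
  apply/allP => d dY; rewrite (allP pY) //=; case/mapP: dY => r rY ->.
  case: hY => _ /allP/(_ r rY)/row_uniq ur _ _.
  by rewrite -(card_uniqP ur) -[leqRHS]card_ord max_card.
exists Y; first by exists (shape Y).
apply/mnmP => u; case/mxvec_indexP: u => a j.
rewrite tableau_mnmE (seq.permP (colY a)) countE /rowdeg.
exact: big_pred1.
Qed.

(** The span follows from a cycle of inclusions: the Schur space lies in the highest weight vectors
    of weight [lam], these in the span of the tableaux, and that span in the Schur space. *)
Theorem RSCT_basis :
  basis_of_subspace (schur_space lam) rsct (@Delta_RSCT K n).
Proof.
split=> [s c us hs|x].
  apply: (lead_indep (B := 2) us (mu := tableau_mnm)) => [Y /hs|Y Y' /hs hY /hs hY'].
    by case/in_Z_shape => _ _ sY _; apply: tableau_lead.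
  exact: tableau_mnm_inj.
split=> [/(schur_highest_weight part_lam) hw|[s [c [hs ->]]]]; last first.
  elim: s hs => [|Y s IH] hs; first by rewrite big_nil; apply: span0.
  rewrite big_cons.
  have [F fF <-] := RSCT_in_schur (hs Y (mem_head _ _)).
  by apply: span_scaleD => //; apply: IH => i hi; apply: hs; rewrite inE hi orbT.
(* Induct on the largest key in the support; the successor makes the measure drop even when the
   leading key is 0. *)
have [N] := ubnP (\max_(m <- msupp x) (key B m).+1); elim: N x hw => // N IH x hw lt.
have [->|nz] := eqVneq x 0; first exact: span0.
have [m lx] := ex_lead nz (highest_weight_small wt_B hw).
have [Y hY mY] := lead_is_tableau hw lx.
have lY : is_lead B (Delta_RSCT K Y) m.
  by rewrite -mY; case/in_Z_shape: hY => _ _ sY _; apply: tableau_lead.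
(* This scalar cancels the coefficient at [m]; the other monomials of both polynomials have smaller
   keys. *)
pose c := x@_m / (Delta_RSCT K Y)@_m.
have -> : x = c *: Delta_RSCT K Y + ((- c) *: Delta_RSCT K Y + x).
  by rewrite scaleNr addrA subrr add0r.
apply: span_scaleD => //; apply: IH.
  apply: highest_weightZD => //; have [F fF <-] := RSCT_in_schur hY.
  exact: filling_highest_weight.
rewrite ltnS in lt; apply: leq_trans lt.
have mb : ((key B m).+1 <= \max_(m <- msupp x) (key B m).+1)%N.
  by apply: (@leq_bigmax_seq _ _ xpredT (fun m => (key B m).+1)) => //; apply: lead_supp lx.
apply: leq_trans mb; rewrite ltnS; apply/bigmax_leqP_seq => m' m'y _.
have ne : m' != m.
  apply: contraTneq m'y => ->; rewrite mcoeff_msupp mcoeffD mcoeffZ negbK.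
  by rewrite /c mulNr divfK ?lY.1 // addrC subrr.
move: m'y; rewrite mcoeff_msupp mcoeffD mcoeffZ => h.
have [z|nz'] := eqVneq (x@_m') 0.
  apply: lY.2 => //; rewrite mcoeff_msupp; apply: contraNneq h => ->.
  by rewrite z mulr0 addr0.
by apply: lx.2 => //; rewrite mcoeff_msupp.
Qed.

End Main.

Theorem theorem1p2 (R : realType) (n : nat) (lam : seq nat) :
  (1 <= n)%N -> is_partition lam -> (size lam <= n)%N ->
  basis_of_subspace
    (schur_space (K := R[i]) (n := n) lam)
    (fun Y : seq (seq 'I_n) => exists2 alpha : seq nat, in_Z n lam alpha & is_RSCT alpha Y)
    (@Delta_RSCT R[i] n).
Proof. by move=> _; apply: RSCT_basis. Qed.
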